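(* Let $(X, \mu)$ be a probability space with an ergodic measure-preserving action of $\mathbb{Z}^2$, and let $A \subseteq X$ be measurable with $\mathrm{Ann}(1_A) \neq \{0\}$. Then there exists a finite index subgroup $\Lambda \subseteq \mathbb{Z}^2$ such that for each $\Lambda$-ergodic component $X_s$ of $X$, either $X_s \cap A$ is 1-periodic or $\mu(X_s \cap A) = \mu(X_s)/2$.
   Context: $R = \mathbb{Z}[u_1^{\pm 1}, u_2^{\pm 1}]$ with $u^g = u_1^{n_1}u_2^{n_2}$ for $g = (n_1,n_2)$; functions on $X$ form an $R$-module via $(\sum_g c_g u^g)\cdot\phi\,(x) = \sum_g c_g\phi((-g)\cdot x)$, and $\mathrm{Ann}(\phi) = \{p \in R : p\cdot\phi = 0 \text{ a.e.}\}$. For a finite index subgroup $\Lambda$, the $\sigma$-algebra of $\Lambda$-invariant measurable sets is finite (by ergodicity); its atoms $X_s$ are called the $\Lambda$-ergodic components of $X$. A measurable set $E$ is 1-periodic if $gE = E$ (up to null sets) for some non-zero $g \in \mathbb{Z}^2$. *)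

(* Defs.v *)
From HB Require Import structures.
From mathcomp Require Import all_boot all_order all_algebra.
From mathcomp Require Import finmap.
From mathcomp Require Import all_classical all_reals all_analysis.

Set Implicit Arguments.
Unset Strict Implicit.
Unset Printing Implicit Defensive.

Import Order.TTheory GRing.Theory Num.Theory.

Local Open Scope classical_set_scope.
Local Open Scope ring_scope.

(* Its canonical zmodType structure is the componentwise addition. *)
Notation Z2 := (int * int)%type.

(* The Laurent polynomial sum_g c_g u^g of Z[u_1^{+-1}, u_2^{+-1}] is given by
   its finitely supported family of coefficients g |-> c_g. *)
Definition laurent := {fsfun Z2 -> int with 0}.

Definition laurent0 : laurent := [fsfun].

Section Action.
Context {d : measure_display} {X : measurableType d} {R : realType}.
Variables (mu : probability X R) (act : Z2 -> X -> X).

Record measure_preserving_action : Prop := MeasurePreservingAction {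
  mpa_id : forall x, act 0 x = x ;
  mpa_comp : forall g h x, act (g + h) x = act g (act h x) ;
  mpa_measurable : forall g, measurable_fun [set: X] (act g) ;
  mpa_preserving : forall g E, measurable E -> mu (act g @^-1` E) = mu E }.

(* gE = E up to null sets *)
Definition fixes_mod_null (g : Z2) (E : set X) : Prop :=
  mu.-negligible ((act g @` E) `+` E).

(* In the definitions below invariance is up to null sets. *)
Definition ergodic_action : Prop :=
  forall E, measurable E -> (forall g, fixes_mod_null g E) ->
    mu E = 0%E \/ mu E = 1%E.

Definition one_periodic (E : set X) : Prop :=
  exists2 g : Z2, g != 0 & fixes_mod_null g E.

Definition invariant_sets (L : {pred Z2}) : set (set X) :=
  [set E | measurable E /\ forall g, g \in L -> fixes_mod_null g E].

(* The atoms of the measure algebra of L-invariant sets; every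
   representative of an atom modulo null sets counts as a component. *)
Definition ergodic_component (L : {pred Z2}) (E : set X) : Prop :=
  [/\ invariant_sets L E, mu E != 0%E &
      forall F, invariant_sets L F -> F `<=` E -> mu F = 0%E \/ mu F = mu E].

Definition laurent_act (p : laurent) (phi : X -> R) : X -> R :=
  fun x => \sum_(g <- finsupp p) (p g)%:~R * phi (act (- g) x).

Definition Ann (phi : X -> R) : set laurent :=
  [set p | {ae mu, forall x, laurent_act p phi x = 0}].

End Action.

Definition finite_index (L : {pred Z2}) : Prop :=
  finite_set (range (fun g : Z2 => [set g + h | h in [set` L]])).

(* Main.v *)
Require Import Defs.
From HB Require Import structures.
From mathcomp Require Import all_boot all_order all_algebra.
From mathcomp Require Import finmap.
From mathcomp Require Import all_classical all_reals all_analysis.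
From mathcomp Require Import measurable_realfun finfield.
From mathcomp Require Import ring lra zify.

(* If [p] annihilates [1_A], then so does [p (u ^ r)] for every [r] prime to a
   fixed integer: modulo a prime [q] one has [p ^ q = p (u ^ q)], and a small
   multiple of [q] is zero. Averaging over [r = 1 + k N] with the ergodic theorem
   writes [1_A] as a sum of functions [psi_i] invariant along pairwise
   non-parallel vectors [h_i]. Since [1_A] is integer valued, difference
   operators along the other directions show that each [psi_i] is polynomial
   modulo 1. On the components of a fine enough lattice, each [psi_i] is then
   either constant modulo 1 or has an irrational constant iterated difference.
   In the second case the conditional expectation of [1_A] along [h_i], which
   takes values in [0, 1], is equidistributed modulo 1, so that its mean, the
   relative measure of [A], is 1/2. If all [psi_i] are constant modulo 1, then
   either some conditional expectation takes values in {0, 1} and coincides with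
   [1_A], or all the [psi_i] are constant; in both cases [A] is 1-periodic on the
   component. *)

Set Implicit Arguments.
Unset Strict Implicit.
Unset Printing Implicit Defensive.

Import Order.TTheory GRing.Theory Num.Theory.
Import numFieldNormedType.Exports.

Local Open Scope classical_set_scope.
Local Open Scope ring_scope.

(** * Bounded measurable functions *)

Section BoundedIntegral.
Context {d : measure_display} {X : measurableType d} {R : realType}.
Variable mu : probability X R.
Implicit Types (f g : X -> R) (E : set X).

(** The functions [psi_i] are bounded, but nothing confines them to [[0, 1]], and uniformity modulo
    1 alone does not determine a mean. The conditional expectation of [\1_A] along a multiple of
    [h_i] does lie in [[0, 1]], where uniformity modulo 1 forces the mean 1/2. The two are linked by
    non-parallelism: averaging [psi_j], [j != i], along [h_i] gives a function invariant in two
    independent directions, hence under a lattice of finite index, so the conditional expectation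
    and [psi_i] have the same iterated differences along that lattice.

    A rational constant difference gives no equidistribution, but it becomes an integer along a
    sparser lattice, which lowers the degree. Sparser lattices split the components further, though
    only into finitely many, because a [Q]-invariant set of positive measure has measure at least
    [1 / Q ^ 2]. One lattice must serve all components and all [i], so the dichotomy is proved for
    all multiples of some modulus. *)

Definition bounded_measurable f :=
  measurable_fun [set: X] f /\ exists C, forall x, `|f x| <= C.
Local Notation bm := bounded_measurable.

Definition expect f : R := \int[mu]_(x in [set: X]) f x.
Local Notation J := expect.

Lemma bm_cst (c : R) : bm (fun=> c).
Proof. by split; [exact: measurable_cst | exists `|c|]. Qed.

Lemma bmD f g : bm f -> bm g -> bm (fun x => f x + g x).
Proof.
move=> [mf [C fC]] [mg [D gD]]; split; first exact: measurable_funD.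
by exists (C + D) => x; rewrite (le_trans (ler_normD _ _))// lerD.
Qed.

Lemma bmM f g : bm f -> bm g -> bm (fun x => f x * g x).
Proof.
move=> [mf [C fC]] [mg [D gD]]; split; first exact: measurable_funM.
by exists (C * D) => x; rewrite normrM ler_pM.
Qed.

Lemma bmZ (c : R) f : bm f -> bm (fun x => c * f x).
Proof. by move=> bf; apply: bmM => //; exact: bm_cst. Qed.

Lemma bmN f : bm f -> bm (fun x => - f x).
Proof.
move=> [mf [C fC]]; split; first exact: measurableT_comp.
by exists C => x; rewrite normrN.
Qed.

Lemma bmB f g : bm f -> bm g -> bm (fun x => f x - g x).
Proof. by move=> bf bg; apply: bmD => //; exact: bmN. Qed.

Lemma bm_sum (I : Type) (s : seq I) (F : I -> X -> R) :
  (forall i, bm (F i)) -> bm (fun x => \sum_(i <- s) F i x).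
Proof.
move=> bF; elim: s => [|i s IH].
  by under eq_fun do rewrite big_nil; exact: bm_cst.
by under eq_fun do rewrite big_cons; exact: bmD.
Qed.

Lemma bm_max f g : bm f -> bm g -> bm (fun x => Num.max (f x) (g x)).
Proof.
move=> [mf [C fC]] [mg [D gD]]; split; first exact: measurable_maxr.
exists (C + D) => x; have C0 := le_trans (normr_ge0 _) (fC x).
have D0 := le_trans (normr_ge0 _) (gD x).
rewrite maxEle; case: ifP => _.
  by apply: (le_trans (gD x)); rewrite lerDr.
by apply: (le_trans (fC x)); rewrite lerDl.
Qed.

Lemma bm_indic E : measurable E -> bm (\1_E).
Proof.
move=> mE; split; first exact: measurable_indic.
exists 1 => x; rewrite indicE; case: (_ \in _); by rewrite ?normr1 ?normr0.
Qed.

Lemma bm_comp (T : X -> X) f : measurable_fun [set: X] T -> bm f -> bm (f \o T).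
Proof.
move=> mT [mf [C fC]]; split; first exact: measurableT_comp.
by exists C => x /=.
Qed.

Lemma bm_cos f : measurable_fun [set: X] f -> bm (fun x => cos (f x)).
Proof.
move=> mf; split.
  apply: (measurableT_comp _ mf); apply: continuous_measurable_fun.
  exact: continuous_cos.
by exists 1 => x; rewrite ler_norml cos_le1 cos_geN1.
Qed.

Lemma bm_sin f : measurable_fun [set: X] f -> bm (fun x => sin (f x)).
Proof.
move=> mf; split.
  apply: (measurableT_comp _ mf); apply: continuous_measurable_fun.
  exact: continuous_sin.
by exists 1 => x; rewrite ler_norml sin_le1 sin_geN1.
Qed.

Lemma bm_integrable f : bm f -> mu.-integrable [set: X] (EFin \o f).
Proof.
move=> [mf [C fC]]; apply: measurable_bounded_integrable => //.
  exact: (le_lt_trans (probability_le1 mu measurableT) (ltry 1)).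
exists C; split; first exact: num_real.
by move=> M CM x _; apply: (le_trans (fC x)); exact: ltW.
Qed.

Lemma expectD f g : bm f -> bm g -> J (fun x => f x + g x) = J f + J g.
Proof. by move=> bf bg; apply: RintegralD => //; exact: bm_integrable. Qed.

Lemma expectZ (c : R) f : bm f -> J (fun x => c * f x) = c * J f.
Proof. by move=> bf; apply: RintegralZl => //; exact: bm_integrable. Qed.

Lemma expectN f : bm f -> J (fun x => - f x) = - J f.
Proof.
move=> bf; rewrite -mulN1r -expectZ//; congr expect.
by apply/funext => x; rewrite mulN1r.
Qed.

Lemma expectB f g : bm f -> bm g -> J (fun x => f x - g x) = J f - J g.
Proof. by move=> bf bg; rewrite expectD ?expectN//; exact: bmN. Qed.

Lemma expect_cst (c : R) : J (fun=> c) = c.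
Proof.
rewrite /expect Rintegral_cst//.
have -> : fine (mu [set: X]) = 1 by rewrite (@probability_setT _ _ _ mu).
by rewrite mulr1.
Qed.

Lemma expect_sum (I : Type) (s : seq I) (F : I -> X -> R) :
  (forall i, bm (F i)) ->
  J (fun x => \sum_(i <- s) F i x) = \sum_(i <- s) J (F i).
Proof.
move=> bF; elim: s => [|i s IH].
  by under eq_fun do rewrite big_nil; rewrite big_nil expect_cst.
under eq_fun do rewrite big_cons.
by rewrite big_cons expectD ?IH//; exact: bm_sum.
Qed.

Lemma expect_indic E : measurable E -> J (\1_E) = fine (mu E).
Proof. by move=> mE; rewrite /expect /Rintegral integral_indic// setIT. Qed.

Lemma eq_expect_ae f g : bm f -> bm g -> {ae mu, forall x, f x = g x} ->
  J f = J g.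
Proof.
move=> [mf _] [mg _] fg; rewrite /expect /Rintegral; congr fine.
apply: ae_eq_integral => //; [exact/measurable_EFinP | exact/measurable_EFinP|].
by apply: filterS fg => x -> _.
Qed.

Lemma le_expect_ae f g : bm f -> bm g -> {ae mu, forall x, f x <= g x} ->
  J f <= J g.
Proof.
move=> bf bg fg; rewrite (@eq_expect_ae g (fun x => Num.max (f x) (g x)))//.
- apply: le_Rintegral => //; [exact: bm_integrable | |].
    by apply: bm_integrable; exact: bm_max.
  by move=> x _; rewrite le_max lexx.
- exact: bm_max.
- by apply: filterS fg => x h; rewrite max_r.
Qed.

Lemma le_expect f g : bm f -> bm g -> (forall x, f x <= g x) -> J f <= J g.
Proof. by move=> bf bg fg; apply: le_expect_ae => //; exact: aeW. Qed.

Lemma expect_ge0_eq0 f : bm f -> {ae mu, forall x, 0 <= f x} -> J f <= 0 ->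
  {ae mu, forall x, f x = 0}.
Proof.
move=> bf f0 Jf0; have [mf [C fC]] := bf.
have bg : bm (fun x => `|f x|).
  by split; [exact: measurableT_comp | exists C => x; rewrite normr_id].
have Jg0 : J (fun x => `|f x|) = 0.
  have -> : J (fun x => `|f x|) = J f.
    by apply: eq_expect_ae => //; apply: filterS f0 => x /ger0_norm.
  apply/eqP; rewrite eq_le Jf0 -(expect_cst 0) le_expect_ae//.
  exact: bm_cst.
have : (\int[mu]_(x in [set: X]) `|(f x)%:E| = 0)%E.
  move: Jg0; rewrite /expect /Rintegral => h.
  rewrite -[LHS]fineK; first by rewrite h.
  by apply: integrable_fin_num => //; exact: bm_integrable bg.
move/ae_eq_integral_abs => /(_ measurableT).
have mEf : measurable_fun [set: X] (EFin \o f) by exact/measurable_EFinP.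
by move=> /(_ mEf); apply: filterS => x /(_ I) [].
Qed.

Lemma expect_dct (F : nat -> X -> R) f (C : R) :
  (forall n, measurable_fun [set: X] (F n)) -> bm f ->
  (forall n x, `|F n x| <= C) ->
  {ae mu, forall x, F n x @[n --> \oo] --> f x} ->
  J (F n) @[n --> \oo] --> J f.
Proof.
move=> mF [mf bf] FC Ff.
have [|||||_ _ h] := @dominated_convergence _ X R mu setT measurableT
  (fun n x => (F n x)%:E) (EFin \o f) (fun=> C%:E).
- by move=> n; exact/measurable_EFinP.
- exact/measurable_EFinP.
- apply: filterS Ff => x h _ /=.
  by apply: cvg_EFin => //; exact: nearW.
- by apply: (@bm_integrable (fun=> C)); exact: bm_cst.
- by apply: aeW => x n _; rewrite lee_fin.
have ff : (\int[mu]_(x in [set: X]) (EFin \o f) x)%E \is a fin_num.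
  by apply: integrable_fin_num => //; exact: bm_integrable.
by move: h; rewrite -(fineK ff) => /fine_cvgP[].
Qed.

Lemma expect_shift (T : X -> X) f : measurable_fun [set: X] T ->
  (forall E, measurable E -> mu (T @^-1` E) = mu E) ->
  bm f -> J (f \o T) = J f.
Proof.
move=> mT hT bf; have [mf _] := bf.
rewrite /expect /Rintegral; congr fine.
have h := @integral_pushforward _ _ X X R T mT mu setT (EFin \o f).
rewrite preimage_setT in h; rewrite -[LHS]h//; first last.
- by apply: (@bm_integrable (f \o T)); exact: bm_comp.
- exact/measurable_EFinP.
by apply: eq_measure_integral => E mE _; exact: hT.
Qed.

End BoundedIntegral.

(** * The pointwise ergodic theorem *)

Section LimSup.
Context {R : realType}.
Implicit Types (u v : R^o^nat) (C : R).

Lemma bounded_seq u C : (forall n, `|u n| <= C) -> bounded_fun u.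
Proof.
move=> uC; exists C; split; first exact: num_real.
by move=> M CM n _; apply: (le_trans (uC n)); exact: ltW.
Qed.

Lemma is_cvg_sups_bounded u C : (forall n, `|u n| <= C) -> cvgn (sups u).
Proof.
move=> /bounded_seq bu; apply/cvg_ex; exists (inf (range (sups u))).
by apply: cvg_sups_inf; [exact: bounded_fun_has_ubound |
  exact: bounded_fun_has_lbound].
Qed.

Lemma le_sups u C n : (forall n, `|u n| <= C) -> u n <= sups u n.
Proof.
move=> uC; apply: ub_le_sup; last by exists n => /=.
exists C => _ [m _ <-]; exact: le_trans (ler_norm _) (uC m).
Qed.

Lemma limn_sup_le u C (b : R) : (forall n, `|u n| <= C) ->
  (forall n, u n <= b) -> limn_sup u <= b.
Proof.
move=> uC ub; apply: limr_le; first exact: is_cvg_sups_bounded uC.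
apply: nearW => n; apply: ge_sup; first by exists (u n); exists n => /=.
by move=> _ [m _ <-].
Qed.

Lemma limn_sup_ge u C (b : R) : (forall n, `|u n| <= C) ->
  (forall n, b <= u n) -> b <= limn_sup u.
Proof.
move=> uC ub; apply: limr_ge; first exact: is_cvg_sups_bounded uC.
by apply: nearW => n; apply: (le_trans (ub n)); exact: le_sups uC.
Qed.

Lemma limn_sup_lt u C (c : R) : (forall n, `|u n| <= C) ->
  limn_sup u < c -> \forall n \near \oo, u n < c.
Proof.
move=> uC uc; have h : \forall n \near \oo, sups u n < c.
  exact: (cvgr_lt _ (is_cvg_sups_bounded uC) _ uc).
by apply: filterS h => n; apply: le_lt_trans; exact: le_sups uC.
Qed.

Lemma limn_sup_subcvg0 u v C D : (forall n, `|u n| <= C) ->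
  (forall n, `|v n| <= D) -> (u n - v n) @[n --> \oo] --> (0 : R^o) ->
  limn_sup u <= limn_sup v.
Proof.
move=> uC vD uv; apply/ler_addgt0Pr => e e0.
have h1 : \forall n \near \oo, u n - v n < e / 2.
  by apply: (cvgr_lt _ uv); rewrite divr_gt0.
have h2 : \forall n \near \oo, v n < limn_sup v + e / 2.
  by apply: (limn_sup_lt vD); rewrite ltrDl divr_gt0.
apply: limr_le; first exact: is_cvg_sups_bounded uC.
have [N _ hN] : \forall n \near \oo, u n <= limn_sup v + e.
  by apply: filterS2 h1 h2 => n a b; lra.
exists N => // n /= Nn; apply: ge_sup; first by exists (u n); exists n => /=.
by move=> _ [m /= nm <-]; apply: hN => /=; exact: leq_trans nm.
Qed.

End LimSup.

(** * Convergence of ergodic averages of bounded functions *)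

Section Birkhoff.
Context {d : measure_display} {X : measurableType d} {R : realType}.
Variable mu : probability X R.
Variable T : X -> X.
Hypothesis mT : measurable_fun [set: X] T.
Hypothesis muT : forall E, measurable E -> mu (T @^-1` E) = mu E.
Local Notation bm := bounded_measurable.
Local Notation J := (expect mu).
Implicit Types (f g : X -> R).

Lemma measurable_iter n : measurable_fun [set: X] (iter n T).
Proof.
by elim: n => [|n IH]; [exact: measurable_id | exact: measurableT_comp].
Qed.

Lemma preserving_iter n E : measurable E -> mu (iter n T @^-1` E) = mu E.
Proof.
elim: n E => // n IH E mE.
have -> : iter n.+1 T @^-1` E = iter n T @^-1` (T @^-1` E) by [].
by rewrite IH ?muT// -[X in measurable X]setTI; exact: mT.
Qed.

Lemma ae_preimage (P : X -> Prop) :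
  {ae mu, forall x, P x} -> {ae mu, forall x, P (T x)}.
Proof.
move=> [N [mN N0 PN]]; exists (T @^-1` N); split.
- by rewrite -[X in measurable X]setTI; exact: mT.
- by rewrite muT.
- by move=> x /= nP; exact: PN.
Qed.

(** The maximum of the sums [\sum_(k < m) g (iter k T x)] over [m <= N], the empty sum included; the
    recursion splits off the first term. *)
Fixpoint running_max g N x : R :=
  if N is N'.+1 then Num.max 0 (g x + running_max g N' (T x)) else 0.

Lemma running_max_ge0 g N x : 0 <= running_max g N x.
Proof. by case: N => //= N; rewrite le_max lexx. Qed.

Lemma running_maxS g N x : running_max g N x <= running_max g N.+1 x.
Proof.
elim: N x => [|N IH] x; first exact: running_max_ge0.
rewrite [leLHS]/=; set z := N.+1; rewrite [leRHS]/= {}/z.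
by rewrite ge_max le_max lexx /= le_max lerD2l IH orbT.
Qed.

Lemma bm_running_max g N : bm g -> bm (running_max g N).
Proof.
move=> bg; elim: N => [|N IH] /=; first exact: bm_cst.
apply: bm_max; first exact: bm_cst.
by apply: bmD => //; exact: (bm_comp mT IH).
Qed.

Lemma running_max_sum g n x :
  \sum_(k < n) g (iter k T x) <= running_max g n x.
Proof.
elim: n x => [|n IH] x; first by rewrite big_ord0.
rewrite big_ord_recl /= le_max lerD2l.
by under eq_bigr do rewrite -iterS iterSr; rewrite IH orbT.
Qed.

(* Garsia: with [F := running_max g], [g * 1_{F_{N+1} > 0} >= F_N - F_N \o T],
   whose right-hand side has expectation zero. *)
Lemma maximal_ergodic g : bm g ->
  (forall x, exists n, 0 < \sum_(k < n.+1) g (iter k T x)) -> 0 <= J g.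
Proof.
move=> bg gpos.
pose P N := [set x | 0 < running_max g N.+1 x].
have mP N : measurable (P N).
  have -> : P N = running_max g N.+1 @^-1` `]0, +oo[.
    by apply/seteqP; split => x /=; rewrite in_itv /= andbT.
  by rewrite -[X in measurable X]setTI; apply: (bm_running_max _ bg).1.
have bP N : bm (fun x => g x * \1_(P N) x) by apply: bmM => //; exact: bm_indic.
have J0 N : 0 <= J (fun x => g x * \1_(P N) x).
  have bF := bm_running_max N bg; have bFT := bm_comp mT bF.
  have <- : J (fun x => running_max g N x - running_max g N (T x)) = 0.
    by rewrite expectB// (expect_shift mT muT bF) subrr.
  apply: le_expect => // [|x]; first exact: bmB.
  rewrite indicE; case: (boolP (x \in P N)) => xP.
    move/set_mem: xP; rewrite mulr1 lerBlDr /P /= lt_max ltxx /= => z0.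
    have := running_maxS g N x; rewrite [X in _ <= X]/= max_r//.
    exact: ltW.
  have {}xP : running_max g N.+1 x <= 0.
    by rewrite leNgt; apply/negP => h; move/negP: xP; apply; exact/mem_set.
  rewrite mulr0 subr_le0; apply: le_trans (running_max_ge0 g N (T x)).
  exact: le_trans (running_maxS g N x) xP.
have [mg [C gC]] := bg.
have cv : J (fun x => g x * \1_(P N) x) @[N --> \oo] --> J g.
  apply: (@expect_dct _ _ _ mu (fun N x => g x * \1_(P N) x) g C) => //.
  - by move=> n; exact: (bP n).1.
  - move=> n x; rewrite normrM indicE; case: (_ \in _).
      by rewrite normr1 mulr1.
    by rewrite normr0 mulr0; exact: le_trans (gC x).
  (* The sets [P N] exhaust the space: a positive partial sum at [x] keeps all later maxima
     positive. *)
  apply: aeW => x; have [n hn] := gpos x.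
  apply: cvg_near_cst; exists n => // m /= nm.
  rewrite indicE mem_set ?mulr1// /P.
  apply: (lt_le_trans hn); apply: (le_trans (running_max_sum _ _ _)).
  have mono k : running_max g n.+1 x <= running_max g (k + n.+1) x.
    elim: k => // k IH; apply: (le_trans IH); rewrite addSn; exact: running_maxS.
  by have := mono (m - n)%N; rewrite addnS subnK.
rewrite -(cvg_lim _ cv)//; apply: limr_ge; last exact: nearW.
by apply/cvg_ex; eexists; exact: cv.
Qed.

Definition ergodic_avg f n x : R := (\sum_(k < n.+1) f (iter k T x)) / n.+1%:R.

Lemma ergodic_avg_itv f a b n x : (forall x, a <= f x <= b) ->
  a <= ergodic_avg f n x <= b.
Proof.
move=> fab; rewrite /ergodic_avg ler_pdivlMr ?ltr0n// ler_pdivrMr ?ltr0n//.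
have e c : c * n.+1%:R = \sum_(k < n.+1) c.
  by rewrite sumr_const card_ord mulr_natr.
rewrite !e; apply/andP; split; apply: ler_sum => i _.
  by have /andP[] := fab (iter i T x).
by have /andP[] := fab (iter i T x).
Qed.

Lemma ergodic_avg_norm f C n x : (forall x, `|f x| <= C) ->
  `|ergodic_avg f n x| <= C.
Proof.
move=> fC; rewrite ler_norml; apply: ergodic_avg_itv => y.
by rewrite -ler_norml.
Qed.

Lemma bm_ergodic_avg f n : bm f -> bm (ergodic_avg f n).
Proof.
move=> bf; apply: bmM; last exact: bm_cst.
apply: bm_sum => k; exact: bm_comp (measurable_iter k) bf.
Qed.

Lemma ergodic_avgT f C x : (forall x, `|f x| <= C) ->
  (ergodic_avg f n (T x) - ergodic_avg f n x) @[n --> \oo] --> (0 : R^o).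
Proof.
move=> fC.
have C0 : 0 <= C by exact: le_trans (normr_ge0 _) (fC x).
have h n : `|ergodic_avg f n (T x) - ergodic_avg f n x| <= 2 * C * n.+1%:R^-1.
  rewrite /ergodic_avg -mulrBl.
  have -> : \sum_(k < n.+1) f (iter k T (T x)) - \sum_(k < n.+1) f (iter k T x)
      = f (iter n.+1 T x) - f x.
    have -> : \sum_(k < n.+1) f (iter k T (T x)) =
        \sum_(k < n) f (iter k.+1 T x) + f (iter n.+1 T x).
      rewrite big_ord_recr -iterSr; congr (_ + _).
      by apply: eq_bigr => k _; rewrite -iterSr.
    by rewrite [X in _ - X]big_ord_recl; ring.
  rewrite normrM normfV (@ger0_norm _ n.+1%:R)// ler_wpM2r//.
  apply: (le_trans (ler_normB _ _)); have := fC (iter n.+1 T x); have := fC x.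
  lra.
apply/norm_cvg0P.
apply: (@squeeze_cvgr _ _ _ _ (fun=> 0) (fun n => 2 * C * n.+1%:R^-1)).
- by apply: nearW => n; rewrite normr_ge0 h.
- exact: cvg_cst.
- rewrite -[X in _ --> X](mulr0 (2 * C)); apply: cvgMl_tmp.
  exact: cvg_harmonic.
Qed.

Definition upper_avg f x : R := limn_sup (ergodic_avg f ^~ x).

Lemma bm_upper_avg f : bm f -> bm (upper_avg f).
Proof.
move=> bf; have [_ [C fC]] := bf.
have bx x := bounded_seq (fun n => ergodic_avg_norm n x fC).
split.
  apply: measurable_fun_limn_sup.
  - by move=> x _; exact: bounded_fun_has_ubound (bx x).
  - by move=> x _; exact: bounded_fun_has_lbound (bx x).
  - by move=> n; exact: (bm_ergodic_avg n bf).1.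
exists C => x; have h n := ergodic_avg_norm n x fC.
rewrite ler_norml; apply/andP; split.
  by apply: (limn_sup_ge h) => n; have := h n; rewrite ler_norml => /andP[].
by apply: (limn_sup_le h) => n; have := h n; rewrite ler_norml => /andP[].
Qed.

Lemma upper_avgT f x : bm f -> upper_avg f (T x) = upper_avg f x.
Proof.
move=> [_ [C fC]]; apply/eqP; rewrite eq_le; apply/andP.
have h y n := ergodic_avg_norm n y fC.
have cv := ergodic_avgT x fC.
split; apply: (limn_sup_subcvg0 (h _) (h _)) => //.
rewrite (_ : (fun n => _) =
  (fun n => - (ergodic_avg f n (T x) - ergodic_avg f n x))).
  by rewrite -[X in _ --> X]oppr0; exact: (cvgN cv).
by apply/funext => n; rewrite opprB.
Qed.

(** Apply [maximal_ergodic] to [f - upper_avg f + e]. As [upper_avg f] is [T]-invariant, a point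
    without positive partial sums would have all averages, hence their upper limit, at most
    [upper_avg f - e]. *)
Lemma expect_upper_avg f : bm f -> J (upper_avg f) <= J f.
Proof.
move=> bf; apply/ler_addgt0Pr => e e0.
have bu := bm_upper_avg bf; have [_ [C fC]] := bf.
have bfu : bm (fun x => f x - upper_avg f x) by exact: bmB.
have : 0 <= J (fun x => (f x - upper_avg f x) + e).
  apply: maximal_ergodic; first by apply: bmD => //; exact: bm_cst.
  move=> x; apply: contrapT => /forallNP hn.
  suff : upper_avg f x <= upper_avg f x - e by lra.
  apply: (limn_sup_le (fun n => ergodic_avg_norm n x fC)) => n.
  have := hn n; move/negP; rewrite -leNgt big_split /= sumrB.
  have uk k : upper_avg f (iter k T x) = upper_avg f x.
    by elim: k => //= k IH; rewrite upper_avgT.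
  under [X in _ - X]eq_bigr do rewrite uk.
  rewrite !sumr_const card_ord /ergodic_avg ler_pdivrMr ?ltr0n//.
  rewrite -(mulr_natr e) -(mulr_natr (upper_avg f x)); lra.
rewrite expectD ?expectB ?expect_cst//; last exact: bm_cst.
lra.
Qed.

(** The limit is represented by the upper limit at every point, so invariance and bounds hold
    everywhere and only convergence is almost sure. It converges because the upper limits for [f]
    and for [- f] have a nonnegative sum with nonpositive expectation. *)
Theorem birkhoff f : bm f -> exists fs, [/\ bm fs,
  (forall x, fs (T x) = fs x),
  (forall a b, (forall x, a <= f x <= b) -> forall x, a <= fs x <= b) &
  {ae mu, forall x, ergodic_avg f n x @[n --> \oo] --> fs x}].
Proof.
move=> bf; have [_ [C fC]] := bf; exists (upper_avg f); split.
- exact: bm_upper_avg.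
- by move=> x; exact: upper_avgT.
- move=> a b fab x; have h n := ergodic_avg_norm n x fC.
  have h' n := ergodic_avg_itv n x fab.
  by rewrite (limn_sup_le h) ?(limn_sup_ge h)// => n; have /andP[] := h' n.
have bNf := bmN bf.
have NfC x : `|- f x| <= C by rewrite normrN.
have NE n x : ergodic_avg (fun x => - f x) n x = - ergodic_avg f n x.
  by rewrite /ergodic_avg sumrN mulNr.
pose g x := upper_avg f x + upper_avg (fun x => - f x) x.
have bu := bm_upper_avg bf; have buN := bm_upper_avg bNf.
have bg : bm g by exact: bmD.
have g0 x : 0 <= g x.
  apply/ler_addgt0Pr => e e0; rewrite -lerBlDr sub0r leNgt; apply/negP => ge.
  have h1 : \forall n \near \oo, ergodic_avg f n x < upper_avg f x + e / 2.
    apply: (limn_sup_lt (fun n => ergodic_avg_norm n x fC)).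
    by rewrite ltrDl divr_gt0.
  have h2 : \forall n \near \oo, ergodic_avg (fun x => - f x) n x <
      upper_avg (fun x => - f x) x + e / 2.
    apply: (limn_sup_lt (fun n => ergodic_avg_norm n x NfC)).
    by rewrite ltrDl divr_gt0.
  have [N _ hN] := filterI h1 h2.
  have [] := hN N (leqnn N); rewrite NE => a b.
  by move: ge; rewrite /g; lra.
have : {ae mu, forall x, g x = 0}.
  apply: expect_ge0_eq0 => //; first exact: aeW.
  rewrite expectD//; have := expect_upper_avg bf; have := expect_upper_avg bNf.
  rewrite expectN//; lra.
apply: filterS => x; rewrite /g => gx.
apply/cvgrPdist_lt => e e0.
have h1 : \forall n \near \oo, ergodic_avg f n x < upper_avg f x + e.
  by apply: (limn_sup_lt (fun n => ergodic_avg_norm n x fC)); rewrite ltrDl.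
have h2 : \forall n \near \oo, ergodic_avg (fun x => - f x) n x <
    upper_avg (fun x => - f x) x + e.
  by apply: (limn_sup_lt (fun n => ergodic_avg_norm n x NfC)); rewrite ltrDl.
apply: filterS2 h1 h2 => n; rewrite NE => a b.
by rewrite ltr_norml; apply/andP; split; lra.
Qed.

Lemma ae_invariant_iter g :
  {ae mu, forall x, g (T x) = g x} ->
  {ae mu, forall x, forall k, g (iter k T x) = g x}.
Proof.
move=> gT; apply: ae_foralln => k; elim: k => [|k IH]; first exact: aeW.
have := ae_preimage IH.
apply: filterS2 gT => x e1 e2; rewrite iterSr e2 e1 //.
Qed.

(** This identifies [fs] as a conditional expectation: by invariance of [g] and [mu] every average
    has the same integral against [g] as [f], and dominated convergence passes to the limit. *)
Lemma expect_ergodic_limit f fs g : bm f -> bm fs -> bm g ->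
  {ae mu, forall x, g (T x) = g x} ->
  {ae mu, forall x, ergodic_avg f n x @[n --> \oo] --> fs x} ->
  J (fun x => g x * fs x) = J (fun x => g x * f x).
Proof.
move=> bf bfs bg gT ffs; have [_ [C fC]] := bf; have [_ [D gD]] := bg.
have gk := ae_invariant_iter gT.
have bgf : bm (fun x => g x * f x) by exact: bmM.
have e n : J (fun x => g x * ergodic_avg f n x) = J (fun x => g x * f x).
  have -> : J (fun x => g x * f x) =
      J (fun x => n.+1%:R^-1 * \sum_(k < n.+1)
        (g (iter k T x) * f (iter k T x))).
    have bk k : bm (fun x => g (iter k T x) * f (iter k T x)).
      exact: (bm_comp (measurable_iter k) bgf).
    rewrite expectZ; last by apply: bm_sum => k.
    rewrite expect_sum//.
    under eq_bigr do
      rewrite (expect_shift (measurable_iter _) (preserving_iter _) bgf).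
    by rewrite sumr_const card_ord -[J _ *+ _]mulr_natl mulrA mulVf ?mul1r.
  apply: eq_expect_ae.
  - by apply: bmM => //; exact: bm_ergodic_avg.
  - apply: bmZ; apply: bm_sum => k.
    exact: (bm_comp (measurable_iter k) bgf).
  apply: filterS gk => x hx; rewrite /= /ergodic_avg mulrA [LHS]mulrC mulr_sumr.
  by congr (_ * _); apply: eq_bigr => k _; rewrite hx.
have cv : J (fun x => g x * ergodic_avg f n x) @[n --> \oo] -->
    J (fun x => g x * fs x).
  apply: (@expect_dct _ _ _ mu (fun n x => g x * ergodic_avg f n x)
    (fun x => g x * fs x) (D * C)).
  - by move=> n; apply: (bmM bg (bm_ergodic_avg n bf)).1.
  - exact: bmM.
  - by move=> n x; rewrite normrM ler_pM// ergodic_avg_norm.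
  by apply: filterS ffs => x; exact: cvgMl_tmp.
apply: (cvg_unique (@Rhausdorff R) cv).
rewrite (_ : (fun n => _) = (fun=> J (fun x => g x * f x))).
  exact: cvg_cst.
by apply/funext => n; rewrite e.
Qed.

End Birkhoff.

(** * Dilation of annihilating polynomials *)

Section Dilation.

Lemma iter_addD (W : zmodType) (P Q : {additive W -> W}) (n : nat) (w : W) :
  (forall w, P (Q w) = Q (P w)) ->
  iter n (fun w => P w + Q w) w =
  \sum_(i < n.+1) iter (n - i) P (iter i Q w) *+ 'C(n, i).
Proof.
move=> PQ; have QiterP k u : Q (iter k P u) = iter k P (Q u).
  by elim: k u => //= k IH u; rewrite -PQ IH.
elim: n => [|n IH]; first by rewrite big_ord1 subnn bin0.
rewrite iterS IH !raddf_sum.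
pose t i := iter (n.+1 - i) P (iter i Q w).
transitivity (\sum_(i < n.+1) t i *+ 'C(n, i) +
              \sum_(i < n.+1) t i.+1 *+ 'C(n, i)).
  congr (_ + _); apply: eq_bigr => i _; rewrite raddfMn.
    have le_in : (i <= n)%N by rewrite -ltnS.
    by rewrite /t (subSn le_in) iterS.
  by rewrite QiterP /t subSS.
rewrite [RHS]big_ord_recl [X in X + _ = _]big_ord_recl /= !bin0 -addrA.
congr (_ + _).
under [RHS]eq_bigr do rewrite /bump /= add1n binS mulrnDr.
rewrite big_split /=; congr (_ + _).
by rewrite big_ord_recr /= bin_small ?addr0.
Qed.

(** The inner binomial coefficients are multiples of [q], which kills [W]. *)
Lemma iter_addD_prime (W : zmodType) (P Q : {additive W -> W}) (q : nat)
    (w : W) :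
  prime q -> (forall w : W, w *+ q = 0) -> (forall w, P (Q w) = Q (P w)) ->
  iter q (fun w => P w + Q w) w = iter q P w + iter q Q w.
Proof.
move=> pq Wq PQ; rewrite iter_addD//.
case: q pq Wq => // q pq Wq.
rewrite big_ord_recr big_ord_recl /= big1 => [|i _].
  by rewrite subnn binn addr0.
have /dvdnP[m ->] : (q.+1 %| 'C(q.+1, bump 0 i))%N.
  by apply: prime_dvd_bin => //; rewrite /bump /= add1n ltnS ltn_ord.
by rewrite mulrnA Wq.
Qed.

Lemma fct_natmulE (U : Type) (F : zmodType) n (w : U -> F) u :
  (w *+ n) u = w u *+ n.
Proof. by elim: n => // n IH; rewrite !mulrS -IH. Qed.

Context {V : zmodType} {I : Type}.

Definition shift_op {F : comPzRingType} (c : F) (v : V) (b : V -> F) : V -> F :=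
  fun h => c * b (h + v).

Fact shift_op_is_zmod_morphism (F : comPzRingType) (c : F) (v : V) :
  zmod_morphism (shift_op c v).
Proof. by move=> a b; apply/funext => h; rewrite /shift_op /= -mulrBr. Qed.

HB.instance Definition _ (F : comPzRingType) (c : F) (v : V) :=
  GRing.isZmodMorphism.Build (V -> F) (V -> F) (shift_op c v)
    (@shift_op_is_zmod_morphism F c v).

(** The action of the polynomial with coefficients [c i] and exponents [v i]. The ring is a
    parameter because both [int] and ['F_q] are needed. *)
Definition conv_op {F : comPzRingType} (s : seq I) (c : I -> F) (v : I -> V)
    (b : V -> F) : V -> F :=
  fun h => \sum_(i <- s) c i * b (h + v i).

Fact conv_op_is_zmod_morphism (F : comPzRingType) s (c : I -> F) v :
  zmod_morphism (conv_op s c v).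
Proof.
move=> a b; apply/funext => h; rewrite /conv_op.
transitivity (\sum_(i <- s) (c i * a (h + v i) - c i * b (h + v i))).
  by apply: eq_bigr => i _; rewrite -mulrBr.
by rewrite sumrB.
Qed.

HB.instance Definition _ (F : comPzRingType) s (c : I -> F) v :=
  GRing.isZmodMorphism.Build (V -> F) (V -> F) (conv_op s c v)
    (@conv_op_is_zmod_morphism F s c v).

Lemma iter_shift_op (F : comPzRingType) (c : F) v n b :
  iter n (shift_op c v) b = shift_op (c ^+ n) (v *+ n) b.
Proof.
elim: n => [|n IH]; apply/funext => h.
  by rewrite /shift_op /= expr0 mul1r mulr0n addr0.
by rewrite iterS IH /shift_op exprS mulrSr addrA mulrA addrAC.
Qed.

(** Split off one monomial at a time: the [q]-th power is additive on commuting operators, and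
    Fermat's [c ^+ q = c] preserves the coefficients. *)
Lemma iter_conv_op (q : nat) s (c : I -> 'F_q) v b : prime q ->
  iter q (conv_op s c v) b = conv_op s c (fun i => v i *+ q) b.
Proof.
move=> pq; have W0 (w : V -> 'F_q) : w *+ q = 0.
  apply/funext => h; transitivity (w h *+ q).
    exact: fct_natmulE.
  by rewrite -mulr_natr (pchar_Fp_0 pq) mulr0.
elim: s => [|i s IH].
  transitivity (0 : V -> 'F_q); last first.
    by apply/funext => h; rewrite /conv_op big_nil.
  (* Here [q != 0] matters: the zeroth iterate of the zero operator is the identity. *)
  case: q pq c b W0 => // q _ c b _.
  by rewrite iterS; apply/funext => h; rewrite /conv_op big_nil.
have -> : conv_op (i :: s) c v =
    (fun b => shift_op (c i) (v i) b + conv_op s c v b).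
  apply/funext => a; apply/funext => h.
  by rewrite /conv_op big_cons.
rewrite iter_addD_prime// => [|w].
  rewrite IH iter_shift_op; apply/funext => h.
  rewrite /conv_op big_cons /shift_op.
  by have := expf_card (c i); rewrite card_Fp// => ->.
apply/funext => h.
change (c i * (\sum_(j <- s) c j * w (h + v i + v j)) =
  \sum_(j <- s) c j * (c i * w (h + v j + v i))); rewrite mulr_sumr.
by apply: eq_bigr => j _; rewrite addrAC mulrCA.
Qed.

(* Frobenius: modulo [q] the [q]-th iterate of the convolution is the dilated
   convolution, and the value is too small to be a nonzero multiple of [q]. *)
Lemma conv_op_dilation_prime s (c : I -> int) v (a : V -> int) (q : nat) :
  prime q -> (\sum_(i <- s) `|c i| < q%:Z) -> (forall h, `|a h| <= 1) ->
  (forall h, conv_op s c v a h = 0) ->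
  forall h, conv_op s c (fun i => v i *+ q) a h = 0.
Proof.
move=> pq cq a1 ca h.
pose b h : 'F_q := (a h)%:~R.
have redE w h' : conv_op s (fun i => (c i)%:~R) w b h' =
    (conv_op s c w a h')%:~R :> 'F_q.
  rewrite /conv_op rmorph_sum /=; apply: eq_bigr => i _.
  by rewrite rmorphM.
have b0 : conv_op s (fun i => (c i)%:~R : 'F_q) v b = 0.
  by apply/funext => h'; rewrite redE ca.
have := iter_conv_op s (fun i => (c i)%:~R) v b pq.
have -> : iter q (conv_op s (fun i => (c i)%:~R : 'F_q) v) b = 0.
  have hk k : iter k.+1 (conv_op s (fun i => (c i)%:~R : 'F_q) v) b = 0.
    by elim: k => [|k IH]; [exact: b0 | rewrite iterS IH raddf0].
  by have := hk q.-1; rewrite (prednK (prime_gt0 pq)).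
move/(congr1 (@^~ h)); rewrite redE.
set z := conv_op _ _ _ _ _ => /esym z0.
have {}z0 : z%:~R = 0 :> 'F_q by exact: z0.
have zlt : `|z| < q%:Z.
  apply: le_lt_trans cq; rewrite /z /conv_op.
  apply: (le_trans (ler_norm_sum _ _ _)); apply: ler_sum => i _.
  by rewrite normrM -[leRHS]mulr1 ler_wpM2l.
have : (q %| `|z|%N)%N.
  rewrite (dvdn_pcharf (pchar_Fp pq)).
  clearbody z; case: z z0 {zlt} => n z0; first by apply/eqP; rewrite -z0.
  by apply/eqP/oppr_inj; rewrite oppr0 -z0 NegzE mulrNz abszN absz_nat.
rewrite -abszE in zlt.
case: (posnP `|z|%N) => [/eqP|z1 /(dvdn_leq z1)]; first by rewrite absz_eq0 => /eqP.
by rewrite leqNgt; move: zlt; rewrite ltz_nat => ->.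
Qed.

(** The prime factors of [r] are peeled off one by one. A dilation changes only the exponents, so
    the same bound on the coefficients serves at each stage. *)
Lemma conv_op_dilation s (c : I -> int) v (a : V -> int) (r : nat) :
  (0 < r)%N ->
  (forall p, prime p -> (p %| r)%N -> \sum_(i <- s) `|c i| < p%:Z) ->
  (forall h, `|a h| <= 1) ->
  (forall h, conv_op s c v a h = 0) ->
  forall h, conv_op s c (fun i => v i *+ r) a h = 0.
Proof.
move=> + + a1 ca; elim/ltn_ind: r => r IH r0 rp.
have [r1|r1] := leqP r 1.
  have -> : r = 1%N by apply/eqP; rewrite eqn_leq r1.
  exact: ca.
have pp := pdiv_prime r1; have pr := pdiv_dvd r.
have er : (r = (r %/ pdiv r) * pdiv r)%N by rewrite divnK.
have rlt : (r %/ pdiv r < r)%N by apply: ltn_Pdiv => //; exact: prime_gt1.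
have r'0 : (0 < r %/ pdiv r)%N by rewrite divn_gt0 ?pdiv_gt0// dvdn_leq.
have := IH _ rlt r'0 _.
have h p : prime p -> (p %| r %/ pdiv r)%N -> \sum_(i <- s) `|c i| < p%:Z.
  by move=> pr' pd; apply: rp => //; rewrite er; apply: dvdn_mulr.
move=> /(_ h)/(conv_op_dilation_prime pp (rp _ pp pr) a1) {}IH x.
rewrite -[RHS](IH x) /conv_op; apply: eq_bigr => i _.
by rewrite -mulrnA -er.
Qed.

End Dilation.

(** * Trigonometry modulo 1 *)

Section Trigo.
Context {R : realType}.
Implicit Types (t z : R).

Definition cos1 t : R := cos (2 * pi * t).
Definition sin1 t : R := sin (2 * pi * t).

Lemma cos1_0 : cos1 0 = 1. Proof. by rewrite /cos1 mulr0 cos0. Qed.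

Lemma cos1N t : cos1 (- t) = cos1 t.
Proof. by rewrite /cos1 mulrN cosN. Qed.

Lemma cos1D t z : cos1 (t + z) = cos1 t * cos1 z - sin1 t * sin1 z.
Proof. by rewrite /cos1 mulrDr cosD. Qed.

Lemma sin1D t z : sin1 (t + z) = sin1 t * cos1 z + cos1 t * sin1 z.
Proof. by rewrite /sin1 mulrDr sinD. Qed.

Lemma cos1B t z : cos1 (t - z) = cos1 t * cos1 z + sin1 t * sin1 z.
Proof. by rewrite /cos1 mulrBr cosB. Qed.

Lemma cos1_sin1_1 : cos1 1 = 1 /\ sin1 1 = 0.
Proof.
rewrite /cos1 /sin1 mulr1 mulr_natl; split.
  by rewrite -[pi *+ 2]add0r cosD2pi cos0.
by rewrite -[pi *+ 2]add0r sinD2pi sin0.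
Qed.

Lemma cos1_sin1_int z : z \is a Num.int -> cos1 z = 1 /\ sin1 z = 0.
Proof.
have [c1 s1] := cos1_sin1_1.
have hn (n : nat) : cos1 n%:R = 1 /\ sin1 n%:R = 0.
  elim: n => [|n [IHc IHs]]; first by rewrite cos1_0 /sin1 mulr0 sin0.
  rewrite -natr1 cos1D sin1D IHc IHs c1 s1; split; ring.
move=> /intrP[m ->]; case: (intP m) => [|n|n]; rewrite ?mulrNz -?pmulrn.
- exact: (hn 0%N).
- exact: hn.
by have [a b] := hn n.+1; rewrite /cos1 /sin1 mulrN cosN sinN
  -/(cos1 _) -/(sin1 _) a b oppr0.
Qed.

Lemma cos1D_int t z : z \is a Num.int -> cos1 (t + z) = cos1 t.
Proof. by move=> /cos1_sin1_int[c s]; rewrite cos1D c s mulr1 mulr0 subr0. Qed.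

Lemma sin1D_int t z : z \is a Num.int -> sin1 (t + z) = sin1 t.
Proof. by move=> /cos1_sin1_int[c s]; rewrite sin1D c s mulr1 mulr0 addr0. Qed.

Lemma cos1_eq_int t z : t - z \is a Num.int -> cos1 t = cos1 z.
Proof. by move=> tz; rewrite -[t](subrKC z) cos1D_int. Qed.

Lemma sin1_eq_int t z : t - z \is a Num.int -> sin1 t = sin1 z.
Proof. by move=> tz; rewrite -[t](subrKC z) sin1D_int. Qed.

Lemma le_cos1 t z : 0 <= z -> z <= 2^-1 -> z <= t -> t <= 1 - z ->
  cos1 t <= cos1 z.
Proof.
move=> z0 z1.
have pi0 : (0 : R) < pi by exact: pi_gt0.
have half s : z <= s -> s <= 2^-1 -> cos1 s <= cos1 z.
  move=> zs s1; rewrite /cos1 leNgt ltr_cos.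
  - by rewrite -leNgt ler_pM2l ?mulr_gt0.
  - by rewrite in_itv /=; apply/andP; split; nra.
  - by rewrite in_itv /=; apply/andP; split; nra.
move=> zt tz; have [|ht] := leP t 2^-1; first exact: half.
have -> : cos1 t = cos1 (1 - t).
  rewrite -[RHS]cos1N opprB; apply: cos1_eq_int.
  by rewrite opprB addrCA subrr addr0 int_num1.
by apply: half; lra.
Qed.

Lemma cos1_lt1 t : 0 < t -> t < 1 -> cos1 t < 1.
Proof.
(* [z] is the distance from [t] to the nearest integer; the outer minimum only makes [z <= 2^-1]
   immediate. *)
move=> t0 t1; pose z := Num.min (Num.min t (1 - t)) 2^-1.
have z0 : 0 < z by rewrite !lt_min t0 subr_gt0 t1 invr_gt0 ltr0n.
have zh : z <= 2^-1 by rewrite ge_min lexx orbT.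
have zt : z <= t by rewrite !ge_min lexx.
have zt' : t <= 1 - z.
  by rewrite lerBrDr addrC -lerBrDr !ge_min lexx orbT.
apply: (le_lt_trans (le_cos1 (ltW z0) zh zt zt')).
have pi0 : (0 : R) < pi by exact: pi_gt0.
rewrite -[ltRHS]cos0 /cos1 ltr_cos.
- by rewrite !mulr_gt0.
- by rewrite in_itv /=; apply/andP; split; nra.
- by rewrite in_itv /=; apply/andP; split; nra.
Qed.

Lemma cos1_eq1 t : cos1 t = 1 -> t \is a Num.int.
Proof.
move=> ct; pose u := t - (Num.floor t)%:~R.
have cu : cos1 u = 1.
  rewrite -ct; apply: cos1_eq_int.
  by rewrite /u addrAC subrr add0r rpredN intr_int.
have /andP[fl fg] := floor_itv t.
have u0 : 0 <= u by rewrite subr_ge0.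
have u1 : u < 1 by move: fg; rewrite /u intrD ltrBlDl.
have [u00|un0] := eqVneq u 0.
  by rewrite -[t](subrK (Num.floor t)%:~R) -/u u00 add0r intr_int.
have := @cos1_lt1 u; rewrite lt_neqAle eq_sym un0 u0 => /(_ isT u1).
by rewrite cu ltxx.
Qed.

(** The linear system has determinant [(1 - c) ^+ 2 + s ^+ 2], positive when [c != 1]. It stands for
    cancelling the complex factor [1 - c - i s]. *)
Lemma rotation_fixed_eq0 (c s u v : R) :
  c != 1 -> u = c * u - s * v -> v = s * u + c * v -> u = 0.
Proof.
move=> c1 eu ev.
have e1 : (1 - c) * u = - s * v by lra.
have e2 : (1 - c) * v = s * u by lra.
have : ((1 - c) ^+ 2 + s ^+ 2) * u = 0.
  have -> : ((1 - c) ^+ 2 + s ^+ 2) * u =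
    (1 - c) * ((1 - c) * u) + s ^+ 2 * u by ring.
  rewrite e1 mulrCA e2; ring.
move/eqP; rewrite mulf_eq0 => /orP[|/eqP//].
rewrite paddr_eq0 ?sqr_ge0// sqrf_eq0 subr_eq0 eq_sym => /andP[h _].
by rewrite h in c1.
Qed.

End Trigo.

(** * Irrational phases *)

Section ActionPhase.
Context {d : measure_display} {X : measurableType d} {R : realType}.
Variables (mu : probability X R) (act : Z2 -> X -> X).
Hypothesis hact : measure_preserving_action mu act.
Local Notation bm := bounded_measurable.
Local Notation J := (expect mu).
Implicit Types (f : X -> R) (E : set X) (v w : Z2).

Lemma act_measurable g : measurable_fun [set: X] (act g).
Proof. exact: mpa_measurable hact g. Qed.

Lemma act_preserving g E : measurable E -> mu (act g @^-1` E) = mu E.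
Proof. exact: mpa_preserving hact g E. Qed.

Lemma actD g h x : act (g + h) x = act g (act h x).
Proof. exact: mpa_comp hact g h x. Qed.

Lemma act0 x : act 0 x = x. Proof. exact: mpa_id hact x. Qed.

Lemma actC g h x : act g (act h x) = act h (act g x).
Proof. by rewrite -!actD addrC. Qed.

Lemma actK g x : act (- g) (act g x) = x.
Proof. by rewrite -actD addNr act0. Qed.

Lemma actKV g x : act g (act (- g) x) = x.
Proof. by rewrite -actD addrN act0. Qed.

Lemma act_mulrSn w n x : act (w *+ n.+1) x = act w (act (w *+ n) x).
Proof. by rewrite mulrS actD. Qed.

Lemma iter_act w n x : iter n (act w) x = act (w *+ n) x.
Proof. by elim: n => [|n IH]; rewrite ?mulr0n ?act0// iterS IH act_mulrSn. Qed.

Lemma ae_countable (I : countType) (P : I -> X -> Prop) :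
  (forall i, {ae mu, forall x, P i x}) ->
  {ae mu, forall x, forall i, P i x}.
Proof.
move=> aP; pose Q n x := oapp (fun i : I => P i x) True (choice.unpickle n).
have : {ae mu, forall x, forall n, Q n x}.
  apply: ae_foralln => n; rewrite /Q.
  by case: (choice.unpickle n) => [i|]; [exact: aP | exact: aeW].
apply: filterS => x Qx i; have := Qx (choice.pickle i).
by rewrite /Q choice.pickleK.
Qed.

(** As the group is countable, the exceptional points of all translates form one null set; pointwise
    arguments along orbits rest on this. *)
Lemma ae_orbit (P : X -> Prop) :
  {ae mu, forall x, P x} -> {ae mu, forall x, forall g, P (act g x)}.
Proof.
move=> aP; apply: (@ae_countable _ (fun (g : Z2) x => P (act g x))) => g.
exact: ae_preimage (act_measurable g) (fun E mE => act_preserving g mE) _ aP.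
Qed.

Definition diffop w f : X -> R := fun x => f (act w x) - f x.

Lemma diffopC v w f : diffop v (diffop w f) = diffop w (diffop v f).
Proof. by apply/funext => x; rewrite /diffop (actC v w); ring. Qed.

Lemma iter_diffopC n v w f :
  diffop v (iter n (diffop w) f) = iter n (diffop w) (diffop v f).
Proof. by elim: n => //= n IH; rewrite diffopC IH. Qed.

Lemma measurable_diffop w f : measurable_fun [set: X] f ->
  measurable_fun [set: X] (diffop w f).
Proof.
move=> mf; apply: measurable_funB => //.
exact: (measurableT_comp mf (act_measurable w)).
Qed.

Lemma measurable_iter_diffop n w f : measurable_fun [set: X] f ->
  measurable_fun [set: X] (iter n (diffop w) f).
Proof. by move=> mf; elim: n => //= n; exact: measurable_diffop. Qed.

Lemma diffop_mulrn w t f x :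
  diffop (w *+ t) f x = \sum_(i < t) diffop w f (act (w *+ i) x).
Proof.
rewrite /diffop; elim: t => [|t IH].
  by rewrite big_ord0 mulr0n act0 subrr.
by rewrite big_ord_recr /= -IH act_mulrSn; ring.
Qed.

Lemma diffop_mulrn_int w t f x (a : R) :
  (forall n : nat, diffop w f (act (w *+ n) x) - a \is a Num.int) ->
  forall n : nat, diffop (w *+ t) f (act (w *+ n) x) - a *+ t \is a Num.int.
Proof.
move=> h n; rewrite diffop_mulrn.
have -> : a *+ t = \sum_(i < t) a by rewrite sumr_const card_ord.
by rewrite -sumrB rpred_sum// => i _; rewrite -actD -mulrnDr.
Qed.

(** A difference along [w *+ t] telescopes into [t] differences along [w], so each of the [n]
    differences contributes a factor [t]. The hypothesis covers the forward orbit because the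
    telescoping visits it. *)
Lemma iter_diffop_mulrn n w t f x (a : R) :
  (forall m : nat, iter n (diffop w) f (act (w *+ m) x) - a \is a Num.int) ->
  forall m : nat,
    iter n (diffop (w *+ t)) f (act (w *+ m) x) - a *+ (t ^ n) \is a Num.int.
Proof.
elim: n f a => [|n IH] f a h m; first by rewrite expn0; exact: h.
have h1 := IH (diffop w f) a; rewrite -iterSr in h1.
have {}h1 := h1 h.
rewrite iterS expnSr mulrnA; apply: diffop_mulrn_int => k.
by rewrite iter_diffopC.
Qed.

Definition irrational_mod1 (a : R) := forall n, (0 < n)%N -> a *+ n \isn't a Num.int.

Lemma ae_invariant_iterates E w : {ae mu, forall x, E (act w x) <-> E x} ->
  {ae mu, forall x, forall (g : Z2) (n : nat),
    E (act (w *+ n) (act g x)) <-> E (act g x)}.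
Proof.
move/ae_orbit; apply: filterS => x h g; elim=> [|n IH]; first by rewrite act0.
by rewrite act_mulrSn -(actD (w *+ n) g) h actD.
Qed.

Lemma expect_indic_shift E v f : measurable E -> bm f ->
  {ae mu, forall x, E (act v x) <-> E x} ->
  J (fun x => \1_E x * f (act v x)) = J (fun x => \1_E x * f x).
Proof.
move=> mE bf Ev; have bi := bm_indic mE (R := R).
have bif : bm (fun x => \1_E x * f x) by exact: bmM.
rewrite -(expect_shift (act_measurable v) (act_preserving v) bif).
apply: eq_expect_ae.
- by apply: bmM => //; exact: (bm_comp (act_measurable v) bf).
- exact: (bm_comp (act_measurable v) bif).
apply: filterS Ev => x Ex /=; congr (_ * _).
by rewrite !indicE; congr (nat_of_bool _)%:R; apply/idP/idP; rewrite !inE => /Ex.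
Qed.

(** Expand the expectation of the square of [\1_E * f - l], with [l] the expectation of
    [\1_E * f]. *)
Lemma expect_indic_sq E f : measurable E -> bm f ->
  (J (fun x => \1_E x * f x)) ^+ 2 <= J (fun x => \1_E x * (f x ^+ 2)).
Proof.
move=> mE bf; have bi := bm_indic mE (R := R).
have bif : bm (fun x => \1_E x * f x) by exact: bmM.
have bif2 : bm (fun x => \1_E x * f x ^+ 2) by apply: bmM => //; exact: bmM.
set l := J _.
have : 0 <= J (fun x => \1_E x * f x ^+ 2 + ((- 2 * l) * (\1_E x * f x) + l ^+ 2)).
  rewrite -(expect_cst mu 0); apply: le_expect; first exact: bm_cst.
    by apply: bmD => //; apply: bmD; [exact: bmZ | exact: bm_cst].
  move=> x; have -> : \1_E x * f x ^+ 2 + (- 2 * l * (\1_E x * f x) + l ^+ 2) =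
      (\1_E x * f x - l) ^+ 2.
    rewrite indicE; case: (x \in E); rewrite /=; ring.
  exact: sqr_ge0.
have bl : bm (fun x => (- 2 * l) * (\1_E x * f x)) by exact: bmZ.
have bc : bm (fun _ : X => l ^+ 2) by exact: bm_cst.
rewrite (expectD mu bif2 (bmD bl bc)) (expectD mu bl bc) expect_cst (expectZ _ _ bif).
by rewrite -/l; lra.
Qed.

(* With [e t := exp (2 i pi t)], the functions [e (f \o act (w *+ k))] are
   orthonormal on [E]: by induction on [n], since [f \o act (w *+ k) - f \o
   act (w *+ l)] has constant [n]-th difference [(k - l) a]. All of them have
   the same inner product with [\1_E], which Bessel's inequality forces to be
   zero. *)
Lemma expect_irrational_phase n E w f (a : R) :
  measurable E -> measurable_fun [set: X] f ->
  {ae mu, forall x, E (act w x) <-> E x} -> irrational_mod1 a ->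
  {ae mu, forall x, E x -> iter n.+1 (diffop w) f x - a \is a Num.int} ->
  J (fun x => \1_E x * cos1 (f x)) = 0.
Proof.
move=> mE mf Ew ira fa; have bi := bm_indic mE (R := R).
have mcos (g : X -> R) : measurable_fun [set: X] g -> bm (fun x => cos1 (g x)).
  by move=> mg; apply: bm_cos; apply: measurable_funM.
have msin (g : X -> R) : measurable_fun [set: X] g -> bm (fun x => sin1 (g x)).
  by move=> mg; apply: bm_sin; apply: measurable_funM.
elim: n f a mf ira fa => [|n IH] f a mf ira fa.
  have bcf := mcos f mf; have bsf := msin f mf.
  set C := J _; pose S := J (fun x => \1_E x * sin1 (f x)).
  (* Moving by [w] adds [a] to the phase, so invariance makes [(C, S)] a fixed vector of the
     rotation by [a]. *)
  have eC : C = cos1 a * C - sin1 a * S.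
    rewrite {1}/C -(expect_indic_shift mE bcf Ew) -!expectZ; try exact: bmM.
    rewrite -expectB; try by apply: bmZ; exact: bmM.
    apply: eq_expect_ae.
    - by apply: bmM => //; exact: (bm_comp (act_measurable w) bcf).
    - by apply: bmB; apply: bmZ; exact: bmM.
    apply: filterS fa => x /= fx; rewrite indicE.
    case: (boolP (x \in E)) => [/set_mem Ex|_] /=; last ring.
    rewrite !mul1r (@cos1_eq_int _ (f (act w x)) (f x + a)).
      by rewrite cos1D; ring.
    by have := fx Ex; rewrite /diffop opprD addrA.
  have eS : S = sin1 a * C + cos1 a * S.
    rewrite {1}/S -(expect_indic_shift mE bsf Ew) -!expectZ; try exact: bmM.
    rewrite -expectD; try by apply: bmZ; exact: bmM.
    apply: eq_expect_ae.
    - by apply: bmM => //; exact: (bm_comp (act_measurable w) bsf).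
    - by apply: bmD; apply: bmZ; exact: bmM.
    apply: filterS fa => x /= fx; rewrite indicE.
    case: (boolP (x \in E)) => [/set_mem Ex|_] /=; last ring.
    rewrite !mul1r (@sin1_eq_int _ (f (act w x)) (f x + a)).
      by rewrite sin1D; ring.
    by have := fx Ex; rewrite /diffop opprD addrA.
  have ca : cos1 a != 1.
    by apply/negP => /eqP /cos1_eq1; apply/negP; have := ira 1%N isT.
  exact: rotation_fixed_eq0 ca eC eS.
pose b (k : nat) x := f (act (w *+ k) x).
have mb k : measurable_fun [set: X] (b k).
  exact: (measurableT_comp mf (act_measurable _)).
have Ek k : {ae mu, forall x, E (act (w *+ k) x) <-> E x}.
  by apply: filterS (ae_invariant_iterates Ew) => x /(_ 0 k); rewrite act0.
have bcb k := mcos _ (mb k); have bsb k := msin _ (mb k).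
have bcbb k l : bm (fun x => \1_E x * cos1 (b k x - b l x)).
  by apply: bmM => //; exact: mcos (measurable_funB (mb k) (mb l)).
set C := J _.
have cor k l : (l < k)%N -> J (fun x => \1_E x * cos1 (b k x - b l x)) = 0.
  move=> lk; pose j := (k - l)%N; have j0 : (0 < j)%N by rewrite subn_gt0.
  have mj := measurable_diffop (w *+ j) mf.
  have -> : J (fun x => \1_E x * cos1 (b k x - b l x)) =
      J (fun x => \1_E x * cos1 (diffop (w *+ j) f x)).
    rewrite -(expect_indic_shift mE (mcos _ mj) (Ek l)); congr expect.
    apply/funext => x; rewrite /b /diffop; congr (_ * cos1 (f _ - _)).
    by rewrite -actD -mulrnDr subnK// ltnW.
  apply: (IH _ (a *+ j)) => //.
    by move=> m m0; rewrite -mulrnA; apply: ira; rewrite muln_gt0 j0.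
  apply: filterS2 (ae_orbit fa) (ae_invariant_iterates Ew) => x h1 h2 Ex.
  rewrite -iter_diffopC -[x]act0 -(mulr0n w); apply: diffop_mulrn_int => m.
  have := h1 (w *+ m); rewrite iterS; apply.
  by have := h2 0 m; rewrite act0 => ->.
have key (K : nat) : (K%:R * C) ^+ 2 <= K%:R.
  pose Sc x := \sum_(k < K) cos1 (b k x); pose Ss x := \sum_(k < K) sin1 (b k x).
  have bSc : bm Sc by exact: bm_sum.
  have bSs : bm Ss by exact: bm_sum.
  have -> : K%:R * C = J (fun x => \1_E x * Sc x).
    under eq_fun do rewrite mulr_sumr.
    rewrite expect_sum => [|k]; last exact: bmM.
    transitivity (\sum_(k < K) C); first by rewrite sumr_const card_ord mulr_natl.
    by apply: eq_bigr => k _; rewrite (expect_indic_shift mE (mcos _ mf) (Ek k)).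
  apply: (le_trans (expect_indic_sq mE bSc)).
  (* Adding the square of the sine sum turns the integrand into a double sum of correlations, of
     which only the [K] diagonal ones survive. *)
  apply: (@le_trans _ _
    (J (fun x => \sum_(k < K) \sum_(l < K) \1_E x * cos1 (b k x - b l x)))).
    apply: le_expect.
    - by apply: bmM => //; exact: bmM.
    - by do 2!(apply: bm_sum => ?); exact: bcbb.
    move=> x.
    have -> : \sum_(k < K) \sum_(l < K) \1_E x * cos1 (b k x - b l x) =
        \1_E x * (Sc x ^+ 2 + Ss x ^+ 2).
      rewrite !expr2 /Sc /Ss !mulr_suml -big_split mulr_sumr.
      apply: eq_bigr => k _; rewrite /= !mulr_sumr -big_split mulr_sumr /=.
      by apply: eq_bigr => l _; rewrite cos1B.
    by rewrite ler_wpM2l ?indicE ?ler0n// lerDl sqr_ge0.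
  rewrite expect_sum => [|k]; last by apply: bm_sum => l; exact: bcbb.
  apply: (@le_trans _ _ (\sum_(k < K) (1 : R))); last first.
    by rewrite sumr_const card_ord.
  apply: ler_sum => k _; rewrite expect_sum => [|l]; last exact: bcbb.
  rewrite (bigD1 k)//= big1 => [|l lk]; last first.
    have [lt|gt|/val_inj e] := ltngtP l k.
    - exact: cor.
    - rewrite -(cor _ _ gt); congr expect; apply/funext => x.
      by rewrite -cos1N opprB.
    - by rewrite e eqxx in lk.
  rewrite addr0 -(expect_cst mu 1); apply: le_expect; [exact: bcbb|exact: bm_cst|].
  move=> x; rewrite subrr cos1_0 mulr1 indicE.
  by case: (_ \in _).
apply/eqP; rewrite -sqrf_eq0; apply/negPn/negP => C0.
have {C0}C0 : 0 < C ^+ 2 by rewrite lt_neqAle eq_sym C0 sqr_ge0.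
(* The bound [K ^ 2 * C ^ 2 <= K] fails once [K] exceeds the inverse of [C ^+ 2]. *)
pose K := (Num.bound (C ^+ 2)^-1).
have K1 : (C ^+ 2)^-1 < K%:R by apply: archi_boundP; rewrite invr_ge0 ltW.
have K0 : 0 < K%:R :> R by apply: lt_trans K1; rewrite invr_gt0.
have := key K; rewrite exprMn expr2 -mulrA -[leRHS]mulr1 ler_pM2l//.
by rewrite leNgt => /negP; apply; rewrite -ltr_pdivrMr// div1r.
Qed.

End ActionPhase.

(** * Equidistribution modulo 1 *)

Section Fejer.
Context {R : realType}.
Implicit Types (s t c : R).

Lemma periodic_sum_shift (h : R -> R) (M : nat) (b c : R) :
  (forall t z, z \is a Num.int -> h (t + z) = h t) -> b * M%:R \is a Num.int ->
  \sum_(j < M) h (c - b * j%:R) = \sum_(j < M) h (c - b * j%:R - b).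
Proof.
move=> hint; case: M => [|M] bM; first by rewrite !big_ord0.
have -> : \sum_(j < M.+1) h (c - b * j%:R - b) =
    \sum_(j < M.+1) h (c - b * j.+1%:R).
  by apply: eq_bigr => j _; rewrite -natr1; congr h; ring.
rewrite big_ord_recl [RHS]big_ord_recr /= addrC; congr (_ + _).
by rewrite mulr0 subr0 hint// rpredN.
Qed.

(** Shifting [j] by one permutes the terms modulo 1 and rotates the vector of cosine and sine sums
    by [p / M] of a turn, nontrivially as [0 < p < M]. *)
Lemma cos1_sum_roots (M p : nat) c : (0 < p < M)%N ->
  \sum_(j < M) cos1 (c - p%:R * (j%:R / M%:R)) = 0.
Proof.
move=> /andP[p0 pM]; pose b : R := p%:R / M%:R.
have M0 : (0 : R) < M%:R by rewrite ltr0n (ltn_trans p0 pM).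
have b0 : 0 < b by apply: divr_gt0 => //; rewrite ltr0n.
have b1 : b < 1 by rewrite ltr_pdivrMr// mul1r ltr_nat.
have eb : b * M%:R = p%:R by rewrite divfK// gt_eqF.
pose F (h : R -> R) := \sum_(j < M) h (c - b * j%:R).
have FS h : (forall t z, z \is a Num.int -> h (t + z) = h t) ->
    F h = \sum_(j < M) h (c - b * j%:R - b).
  by move=> hint; apply: periodic_sum_shift => //; rewrite eb natr_int.
have Fc : F cos1 = cos1 b * F cos1 - (- sin1 b) * F sin1.
  rewrite {1}FS; last exact: cos1D_int.
  rewrite mulNr opprK /F !mulr_sumr -big_split /=.
  by apply: eq_bigr => j _; rewrite cos1B; ring.
have Fs : F sin1 = (- sin1 b) * F cos1 + cos1 b * F sin1.
  rewrite {1}FS; last exact: sin1D_int.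
  rewrite /F !mulr_sumr -big_split /=.
  apply: eq_bigr => j _; rewrite sin1D cos1N.
  have -> : sin1 (- b) = - sin1 b by rewrite /sin1 mulrN sinN.
  ring.
have cb : cos1 b != 1 by rewrite lt_eqF// cos1_lt1.
rewrite -[RHS](rotation_fixed_eq0 cb Fc Fs) /F.
by apply: eq_bigr => j _; congr cos1; rewrite /b; ring.
Qed.

(** The squared modulus of the sum of [exp (2 i pi n s)] over [n < M], that is [M] times the Fejer
    kernel. *)
Definition dirichlet_sq (M : nat) s : R :=
  \sum_(n < M) \sum_(k < M) cos1 (n%:R * s - k%:R * s).

Lemma dirichlet_sqE M s : dirichlet_sq M s =
  (\sum_(n < M) cos1 (n%:R * s)) ^+ 2 + (\sum_(n < M) sin1 (n%:R * s)) ^+ 2.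
Proof.
rewrite !expr2 !mulr_suml -big_split; apply: eq_bigr => n _ /=.
by rewrite !mulr_sumr -big_split; apply: eq_bigr => k _; rewrite cos1B.
Qed.

Lemma dirichlet_sq_ge0 M s : 0 <= dirichlet_sq M s.
Proof. by rewrite dirichlet_sqE addr_ge0// sqr_ge0. Qed.

Lemma cos1_sin1_sq s : cos1 s ^+ 2 + sin1 s ^+ 2 = 1.
Proof. exact: cos2Dsin2. Qed.

Lemma dirichlet_sq_le M s : (1 - cos1 s) * dirichlet_sq M s <= 2.
Proof.
pose U m := \sum_(n < m) cos1 (n%:R * s).
pose V m := \sum_(n < m) sin1 (n%:R * s).
(* With [e t := exp (2 i pi t)], these are the real and imaginary parts of the geometric sum
   identity [(e s - 1) * \sum_(n < m) e (n s) = e (m s) - 1]. *)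
have h m : (cos1 s - 1) * U m - sin1 s * V m = cos1 (m%:R * s) - 1 /\
    sin1 s * U m + (cos1 s - 1) * V m = sin1 (m%:R * s).
  elim: m => [|m [IHc IHs]].
    by rewrite /U /V !big_ord0 !mul0r cos1_0 /sin1 !mulr0 sin0; split; ring.
  rewrite /U /V !big_ord_recr /= -/(U m) -/(V m).
  have -> : m.+1%:R * s = m%:R * s + s by rewrite -natr1; ring.
  rewrite cos1D sin1D; split; lra.
have [hc hs] := h M; rewrite dirichlet_sqE -/(U M) -/(V M).
have e : (2 - 2 * cos1 s) * (U M ^+ 2 + V M ^+ 2) =
    (cos1 (M%:R * s) - 1) ^+ 2 + sin1 (M%:R * s) ^+ 2.
  rewrite -hc -hs.
  have -> : 2 - 2 * cos1 s = cos1 s ^+ 2 + sin1 s ^+ 2 + 1 - 2 * cos1 s.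
    by rewrite cos1_sin1_sq; ring.
  ring.
have e2 := cos1_sin1_sq (M%:R * s).
have e3 : -1 <= cos1 (M%:R * s) by exact: cos_geN1.
set x := cos1 (M%:R * s) in e e2 e3 *; set y := sin1 _ in e e2 *.
set z := U M ^+ 2 + _ in e *; set w := cos1 s in e *.
have : (x - 1) ^+ 2 + y ^+ 2 = 2 - 2 * x by rewrite sqrrB1; lra.
move=> e4; rewrite e4 in e; lra.
Qed.

(** The terms with [n != k] cancel over the roots, and each of the [M] diagonal terms contributes
    [M]. *)
Lemma dirichlet_sq_sum_roots M t : (0 < M)%N ->
  \sum_(j < M) dirichlet_sq M (t - j%:R / M%:R) = M%:R ^+ 2.
Proof.
move=> M0; rewrite /dirichlet_sq exchange_big /=.
have -> : M%:R ^+ 2 = \sum_(n < M) (M%:R : R).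
  by rewrite sumr_const card_ord expr2 mulr_natr.
apply: eq_bigr => n _; rewrite exchange_big /= (bigD1 n)//= [X in _ + X]big1 => [|k kn].
  rewrite addr0; transitivity (\sum_(j < M) (1 : R)).
    by apply: eq_bigr => j _; rewrite addrN cos1_0.
  by rewrite sumr_const card_ord.
have main (a b : nat) : (a < b < M)%N ->
    \sum_(j < M) cos1 (b%:R * (t - j%:R / M%:R) - a%:R * (t - j%:R / M%:R)) = 0.
  move=> /andP[ab bM].
  rewrite -[RHS](@cos1_sum_roots M (b - a) ((b - a)%:R * t)); last first.
    by rewrite subn_gt0 ab (leq_ltn_trans (leq_subr _ _)).
  by apply: eq_bigr => j _; congr cos1; rewrite natrB ?(ltnW ab)//; ring.
have [lt|gt|/val_inj e] := ltngtP k n.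
- by apply: main; rewrite lt ltn_ord.
- rewrite -[RHS](main n k) ?gt ?ltn_ord//; apply: eq_bigr => j _.
  by rewrite -cos1N opprB.
- by rewrite e eqxx in kn.
Qed.

Lemma dirichlet_sq_far (M : nat) (dl s : R) : 0 < dl -> dl <= 2^-1 ->
  dl <= `|s| -> `|s| <= 1 - dl ->
  dirichlet_sq M s <= 2 / (1 - cos1 dl).
Proof.
move=> d0 d1 ds sd; have cd : cos1 dl < 1 by apply: cos1_lt1 => //; lra.
have cs : cos1 s <= cos1 dl.
  have -> : cos1 s = cos1 `|s|.
    by case: (ler0P s) => _; rewrite ?cos1N.
  by apply: le_cos1 => //; exact: ltW.
rewrite ler_pdivlMr ?subr_gt0// mulrC.
apply: le_trans (dirichlet_sq_le M s); apply: ler_wpM2r.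
  exact: dirichlet_sq_ge0.
by rewrite lerD2l lerN2.
Qed.

Lemma le_archi (x a b : R) :
  (forall r : nat, (0 < r)%N -> x <= a + b / r%:R) -> x <= a.
Proof.
move=> h; apply/ler_addgt0Pr => e e0.
pose r := (Num.bound (`|b| / e)).+1.
have : `|b| / e < r%:R.
  apply: (lt_le_trans (archi_boundP _)); first by rewrite divr_ge0// ltW.
  by rewrite ler_nat.
rewrite ltr_pdivrMr// => br; apply: (le_trans (h r isT)); rewrite lerD2l.
rewrite ler_pdivrMr ?ltr0n//; apply: (le_trans (ler_norm b)).
by rewrite mulrC ltW.
Qed.

Lemma sum_leq_ord (n r : nat) : (\sum_(j < n) (j <= r) <= r.+1)%N.
Proof.
suff : (\sum_(j < n) (j <= r) <= minn n r.+1)%N.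
  by move/leq_trans; apply; exact: geq_minr.
elim: n => [|n IH]; first by rewrite big_ord0.
rewrite big_ord_recr /=; move: IH; set S := bigop _ _ _.
by have [nr|nr] := leqP n r => /= IH; lia.
Qed.

Lemma sum_geq_ord (n a : nat) : (\sum_(j < n) (a <= j) <= n - a)%N.
Proof.
elim: n => [|n IH]; first by rewrite big_ord0.
rewrite big_ord_recr /=; move: IH; set S := bigop _ _ _.
by have [an|an] := leqP a n => /= IH; lia.
Qed.

End Fejer.

Section Equidistribution.
Context {d : measure_display} {X : measurableType d} {R : realType}.
Variable mu : probability X R.
Local Notation bm := bounded_measurable.
Local Notation J := (expect mu).

(* The weights [dirichlet_sq M (t - j / M) / M ^ 2] form a probability on the
   [M]-th roots of unity concentrated near [t]; averaged over [t = g x] they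
   give each root the same mass. *)
Lemma expect_equidistributed (E : set X) (g : X -> R) :
  measurable E -> measurable_fun [set: X] g -> (forall x, 0 <= g x <= 1) ->
  (forall (n : nat) c, (0 < n)%N ->
    J (fun x => \1_E x * cos1 (n%:R * g x + c)) = 0) ->
  J (fun x => \1_E x * g x) = fine (mu E) / 2.
Proof.
move=> mE mg g01 Jcos.
have g0 x : 0 <= g x by have /andP[] := g01 x.
have g1 x : g x <= 1 by have /andP[] := g01 x.
have bi := bm_indic mE (R := R).
have bg : bm g.
  by split => //; exists 1 => x; rewrite ger0_norm.
have big : bm (fun x => \1_E x * g x) by exact: bmM.
have bcos (a c : R) : bm (fun x => cos1 (a * g x + c)).
  apply: bm_cos; apply: measurable_funM => //.
  by apply: measurable_funD => //; exact: measurable_funM.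
set m := fine (mu E); set G := J _.
have m0 : 0 <= m by rewrite fine_ge0.
have m1 : m <= 1.
  rewrite -[leRHS]/(fine 1%:E) fine_le//; last exact: probability_le1.
  by rewrite fin_num_measure.
have Jm : J (\1_E) = m by exact: expect_indic.
pose w M j t : R := dirichlet_sq M (t - j%:R / M%:R) / M%:R ^+ 2.
have w0 M j t : 0 <= w M j t.
  by rewrite divr_ge0 ?sqr_ge0// dirichlet_sq_ge0.
have bw M j : bm (fun x => w M j (g x)).
  apply: bmM; last exact: bm_cst.
  apply: bm_sum => n; apply: bm_sum => k.
  have -> : (fun x => cos1 (n%:R * (g x - j%:R / M%:R) - k%:R *
      (g x - j%:R / M%:R))) = (fun x => cos1 ((n%:R - k%:R) * g x +
      (- (n%:R - k%:R) * (j%:R / M%:R)))).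
    by apply/funext => x; congr cos1; ring.
  exact: bcos.
have Jw M j : (0 < M)%N -> J (fun x => \1_E x * w M j (g x)) = m / M%:R.
  move=> M0; have Mn0 : (M%:R : R) != 0 by rewrite pnatr_eq0 -lt0n.
  pose cc (n k : nat) x := \1_E x * cos1 (n%:R * (g x - j%:R / M%:R) - k%:R *
      (g x - j%:R / M%:R)).
  have ccE n k : cc n k = fun x => \1_E x * cos1 ((n%:R - k%:R) * g x +
      (- (n%:R - k%:R) * (j%:R / M%:R))).
    by apply/funext => x; congr (_ * cos1 _); ring.
  have bcc n k : bm (cc n k) by rewrite ccE; apply: bmM => //; exact: bcos.
  have -> : (fun x => \1_E x * w M j (g x)) =
      (fun x => M%:R ^- 2 * \sum_(n < M) \sum_(k < M) cc n k x).
    apply/funext => x; rewrite /w /dirichlet_sq mulrA mulrC; congr (_ * _).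
    rewrite mulr_sumr; apply: eq_bigr => n _.
    by rewrite mulr_sumr.
  rewrite expectZ; last by do 2!(apply: bm_sum => ?).
  rewrite expect_sum => [|n]; last by apply: bm_sum.
  have -> : \sum_(n < M) J (fun x => \sum_(k < M) cc n k x) = \sum_(n < M) m.
    apply: eq_bigr => n _; rewrite expect_sum//.
    have dgt (a b : nat) : (a < b)%N -> J (cc b a) = 0.
      move=> ab; rewrite ccE -natrB ?(ltnW ab)//; apply: Jcos.
      by rewrite subn_gt0.
    rewrite (bigD1 n)//= big1 => [|k kn].
      rewrite addr0 -Jm; congr expect; apply/funext => x.
      by rewrite /cc subrr cos1_0 mulr1.
    have [lt|gt|/val_inj e] := ltngtP k n.
    - exact: dgt.
    - rewrite -(dgt _ _ gt); congr expect; apply/funext => x.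
      by rewrite /cc -cos1N opprB.
    - by rewrite e eqxx in kn.
  rewrite sumr_const card_ord -[m *+ _]mulr_natr; field.
  by rewrite Mn0.
suff : `|G - m / 2| <= 0 by rewrite normr_le0 subr_eq0 => /eqP.
(* Resolution [1 / q] costs [1 / q] for the roots near [g x] and about [2 / q] for the mass of the
   roots near 0 and 1. *)
suff H (q : nat) : (1 < q)%N -> `|G - m / 2| <= 3 / q%:R.
  apply: (@le_archi _ _ 0 3) => r r0; rewrite add0r.
  have [r1|] := leqP r 1; last exact: H.
  have -> : r = 1%N by apply/eqP; rewrite eqn_leq r1.
  apply: (le_trans (H 2%N isT)); lra.
move=> q1; have q0 : (0 : R) < q%:R by rewrite ltr0n; exact: ltn_trans q1.
pose dl : R := q%:R^-1.
have dl0 : 0 < dl by rewrite invr_gt0.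
have dl2 : dl <= 2^-1 by rewrite /dl lef_pV2 ?posrE// (ler_nat _ 2%N).
pose K : R := 2 / (1 - cos1 dl).
have cdl : cos1 dl < 1 by apply: cos1_lt1 => //; lra.
have K0 : 0 <= K by rewrite divr_ge0// subr_ge0 ltW.
(* With [M = q * r] the excess is at most [(K + 2) / M]: [K / M] from the roots far from [g x],
   [1 / M] from counting the end roots, and at most [1 / M] from the mean of the roots. It vanishes
   as [r] grows. *)
apply: (@le_archi _ _ _ ((K + 2) / q%:R)) => r r0.
have r0' : (0 : R) < r%:R by rewrite ltr0n.
pose M := (q * r)%N.
have M0 : (0 < M)%N by rewrite muln_gt0 r0 andbT; exact: ltn_trans q1.
have MR0 : (0 : R) < M%:R by rewrite ltr0n.
have Mn0 : (M%:R : R) != 0 by rewrite gt_eqF.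
have w1 t : \sum_(j < M) w M j t = 1.
  by rewrite -mulr_suml dirichlet_sq_sum_roots// divff// expf_neq0.
(* Roots near the ends of [[0, 1]]: only there can [j / M] be close to [g x] modulo 1 without being
   close to it. *)
pose B (j : nat) := (j <= r)%N || (M - r <= j)%N.
pose D x := \sum_(j < M) w M j (g x) * (g x - j%:R / M%:R).
pose H x := dl + K / M%:R + \sum_(j < M) (B j)%:R * w M j (g x).
have DH x : `|D x| <= H x.
  apply: (le_trans (ler_norm_sum _ _ _)).
  have -> : H x = \sum_(j < M)
      (dl * w M j (g x) + K / M%:R ^+ 2 + (B j)%:R * w M j (g x)).
    rewrite big_split /= big_split /= -mulr_sumr w1 mulr1 sumr_const card_ord.
    by rewrite -[_ *+ M]mulr_natr /H; congr (_ + _ + _); field.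
  apply: ler_sum => j _; rewrite normrM ger0_norm//.
  have KM : 0 <= K / M%:R ^+ 2 by rewrite divr_ge0// sqr_ge0.
  have Bw : 0 <= (B j)%:R * w M j (g x) by rewrite mulr_ge0.
  have dw : 0 <= dl * w M j (g x) by rewrite mulr_ge0// ltW.
  set s := g x - _.
  have j0 : 0 <= j%:R / M%:R :> R by rewrite divr_ge0.
  have j1 : j%:R / M%:R < 1 :> R.
    by rewrite ltr_pdivrMr// mul1r ltr_nat.
  have s1 : `|s| <= 1.
    rewrite ler_norml /s; have := g0 x; have := g1 x.
    by clear -j0 j1 => *; apply/andP; split; lra.
  have [sd|sd] := leP `|s| dl.
    rewrite -addrA; apply: ler_wpDr; first by rewrite addr_ge0.
    by rewrite mulrC ler_wpM2r.
  have [sd'|sd'] := leP `|s| (1 - dl).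
    have -> : dl * w M j (g x) + K / M%:R ^+ 2 + (B j)%:R * w M j (g x) =
        K / M%:R ^+ 2 + (dl * w M j (g x) + (B j)%:R * w M j (g x)) by ring.
    apply: ler_wpDr; first by rewrite addr_ge0.
    apply: (@le_trans _ _ (w M j (g x))).
      by rewrite -[leRHS]mulr1 ler_wpM2l.
    rewrite ler_wpM2r ?invr_ge0 ?sqr_ge0//.
    by apply: dirichlet_sq_far => //; exact: ltW.
  rewrite addrC; apply: ler_wpDr; first by rewrite addr_ge0.
  suff -> : B j by rewrite mul1r -[leRHS]mulr1 ler_wpM2l.
  have edl : dl = r%:R / M%:R.
    by rewrite /M natrM /dl; field; rewrite !gt_eqF.
  have : j%:R / M%:R <= dl \/ 1 - dl <= j%:R / M%:R :> R.
    have [jd|jd] := leP (j%:R / M%:R) dl; first by left.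
    have [jd'|jd'] := leP (1 - dl) (j%:R / M%:R); first by right.
    have : `|s| < 1 - dl.
      rewrite ltr_norml /s; have := g0 x; have := g1 x.
      by clear -j0 j1 jd jd' => *; apply/andP; split; lra.
    by move/(lt_trans sd'); rewrite ltxx.
  rewrite /B edl => -[].
    by rewrite ler_pM2r ?invr_gt0// ler_nat => ->.
  have -> : 1 - r%:R / M%:R = (M - r)%:R / M%:R :> R.
    rewrite natrB ?mulrBl ?divff// /M leq_pmull//.
    exact: ltn_trans q1.
  by rewrite ler_pM2r ?invr_gt0// ler_nat => ->; rewrite orbT.
have bD : bm D.
  by apply: bm_sum => j; apply: bmM => //; apply: bmB => //; exact: bm_cst.
have bBw : bm (fun x => \sum_(j < M) (B j)%:R * w M j (g x)).
  by apply: bm_sum => j; exact: bmZ.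
have bH : bm H by apply: bmD => //; exact: bm_cst.
have JD : J (fun x => \1_E x * D x) = G - m * (M%:R - 1) / (2 * M%:R).
  have -> : (fun x => \1_E x * D x) =
      (fun x => \1_E x * g x -
        \sum_(j < M) (j%:R / M%:R) * (\1_E x * w M j (g x))).
    apply/funext => x; rewrite /D.
    under eq_bigr do rewrite mulrBr.
    rewrite sumrB -mulr_suml w1 mul1r mulrBr mulr_sumr; congr (_ - _).
    by apply: eq_bigr => j _; ring.
  have bj (j : 'I_M) : bm (fun x => (j%:R / M%:R) * (\1_E x * w M j (g x))).
    by apply: bmZ; exact: bmM.
  rewrite expectB//; last exact: bm_sum.
  congr (_ - _); rewrite expect_sum//.
  under eq_bigr => j _ do rewrite (expectZ mu _ (bmM bi (bw M j))) Jw//.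
  have -> : \sum_(j < M) j%:R / M%:R * (m / M%:R) =
      (\sum_(j < M) (j%:R : R)) * (m / M%:R ^+ 2).
    by rewrite mulr_suml; apply: eq_bigr => j _; field.
  have -> : \sum_(j < M) (j%:R : R) = M%:R * (M%:R - 1) / 2.
    elim: (M) => [|k IH]; first by rewrite big_ord0 mul0r mul0r.
    by rewrite big_ord_recr /= IH -natr1; field.
  by field.
have JH : J (fun x => \1_E x * H x) <= m * (dl + K / M%:R + (2 * r + 1)%:R / M%:R).
  have -> : (fun x => \1_E x * H x) = (fun x => (dl + K / M%:R) * \1_E x +
      \sum_(j < M) (B j)%:R * (\1_E x * w M j (g x))).
    apply/funext => x; rewrite /H mulrDr mulrC; congr (_ + _).
    by rewrite mulr_sumr; apply: eq_bigr => j _; rewrite mulrCA.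
  have bj (j : 'I_M) : bm (fun x => (B j)%:R * (\1_E x * w M j (g x))).
    by apply: bmZ; exact: bmM.
  rewrite expectD ?expectZ//; [|exact: bmZ|exact: bm_sum].
  rewrite Jm expect_sum//.
  under eq_bigr => j _ do rewrite (expectZ mu _ (bmM bi (bw M j))) Jw//.
  rewrite -mulr_suml -natr_sum.
  have Bc : (\sum_(j < M) B j <= 2 * r + 1)%N.
    apply: (@leq_trans (\sum_(j < M) ((j <= r) + (M - r <= j)))%N).
      by apply: leq_sum => j _; rewrite /B; case: (j <= r)%N; case: (M - r <= j)%N.
    have -> : (2 * r + 1 = r.+1 + r)%N by rewrite mul2n -addnn addn1.
    rewrite big_split; apply: leq_add; first exact: sum_leq_ord.
    apply: (leq_trans (sum_geq_ord _ _)).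
    by rewrite leq_subLR addnC -leq_subLR.
  rewrite mulrDr mulrC lerD2l.
  have -> : m * ((2 * r + 1)%:R / M%:R) = (2 * r + 1)%:R * (m / M%:R) by ring.
  by rewrite ler_wpM2r ?divr_ge0// ler_nat.
have GD : `|G - m * (M%:R - 1) / (2 * M%:R)| <=
    m * (dl + K / M%:R + (2 * r + 1)%:R / M%:R).
  rewrite -JD ler_norml; apply/andP; split.
    rewrite lerNl -expectN; last exact: bmM.
    apply: le_trans JH; apply: le_expect; [exact/bmN/bmM|exact: bmM|] => x.
    rewrite -mulrN ler_wpM2l ?indicE ?ler0n//.
    by apply: le_trans (DH x); rewrite -normrN ler_norm.
  apply: le_trans JH; apply: le_expect; [exact: bmM|exact: bmM|] => x.
  rewrite ler_wpM2l ?indicE ?ler0n//.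
  by apply: le_trans (DH x); exact: ler_norm.
have e1 : m * (M%:R - 1) / (2 * M%:R) = m / 2 - m / (2 * M%:R) by field.
have e2 : (2 * r + 1)%:R / M%:R = 2 * dl + M%:R^-1 :> R.
  by rewrite /dl /M natrD !natrM; field; rewrite !gt_eqF.
have e3 : (K + 2) / q%:R / r%:R = K / M%:R + 2 * M%:R^-1.
  by rewrite /M natrM; field; rewrite !gt_eqF.
have e4 : 3 / q%:R = 3 * dl by [].
rewrite e3 e4; rewrite e1 e2 in GD.
have Mi : 0 <= M%:R^-1 :> R by rewrite invr_ge0.
have KMi : 0 <= K / M%:R by rewrite divr_ge0.
have mM : m / (2 * M%:R) <= M%:R^-1.
  have -> : m / (2 * M%:R) = m * (M%:R^-1 / 2) by field.
  apply: (@le_trans _ _ (1 * (M%:R^-1 / 2))); last lra.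
  by rewrite ler_wpM2r// divr_ge0.
have mM0 : 0 <= m / (2 * M%:R) by rewrite divr_ge0// mulr_ge0.
have := GD; rewrite !ler_norml => /andP[h1 h2].
have h3 : m * (dl + K / M%:R + (2 * dl + M%:R^-1)) <=
    1 * (dl + K / M%:R + (2 * dl + M%:R^-1)).
  by rewrite ler_wpM2r// !addr_ge0// ?mulr_ge0// ltW.
by apply/andP; split; lra.
Qed.

End Equidistribution.

(** * Splitting the indicator into directional parts *)

Definition detz (u v : Z2) : int := u.1 * v.2 - u.2 * v.1.

Lemma mulrz_fst (u : Z2) (a : int) : (u *~ a).1 = u.1 * a.
Proof. by rewrite -mulrzz -(raddfMz fst). Qed.

Lemma mulrz_snd (u : Z2) (a : int) : (u *~ a).2 = u.2 * a.
Proof. by rewrite -mulrzz -(raddfMz snd). Qed.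

Lemma Z2_eqP (u v : Z2) : u.1 = v.1 -> u.2 = v.2 -> u = v.
Proof. by case: u => a b; case: v => c e /= -> ->. Qed.

Lemma detz_mulrzl u v a : detz (u *~ a) v = detz u v * a.
Proof. by rewrite /detz mulrz_fst mulrz_snd; ring. Qed.

Lemma detzC u v : detz u v = - detz v u.
Proof. by rewrite /detz; ring. Qed.

(** Cramer's rule, by which two non-parallel vectors span a lattice of finite index. *)
Lemma detz_cramer u v z : z *~ detz u v = u *~ detz z v + v *~ detz u z.
Proof.
by apply: Z2_eqP; rewrite /= !(mulrz_fst, mulrz_snd) /detz; ring.
Qed.

Lemma mulrz_eq0_Z2 (u : Z2) (a : int) : u != 0 -> a != 0 -> u *~ a != 0.
Proof.
move=> u0 a0; apply: contra u0 => /eqP e; apply/eqP; apply: Z2_eqP => /=.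
  have /(congr1 fst) := e; rewrite mulrz_fst /= => /eqP.
  by rewrite mulf_eq0 (negPf a0) orbF => /eqP.
have /(congr1 snd) := e; rewrite mulrz_snd /= => /eqP.
by rewrite mulf_eq0 (negPf a0) orbF => /eqP.
Qed.

Lemma detz_eq0_common (u v : Z2) : u != 0 -> v != 0 -> detz u v = 0 ->
  exists a b : int, [/\ a != 0, b != 0 & u *~ a = v *~ b].
Proof.
move=> u0 v0 /eqP; rewrite /detz subr_eq0 => /eqP uv.
have [u1|u1] := eqVneq u.1 0.
  have u2 : u.2 != 0.
    by apply: contra u0 => /eqP u2; apply/eqP; exact: Z2_eqP.
  have v1 : v.1 = 0.
    by move/esym/eqP: uv; rewrite u1 mul0r mulf_eq0 (negPf u2) => /eqP.
  have v2 : v.2 != 0.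
    by apply: contra v0 => /eqP v2; apply/eqP; exact: Z2_eqP.
  exists v.2, u.2; split => //.
  by apply: Z2_eqP; rewrite !(mulrz_fst, mulrz_snd) ?u1 ?v1; ring.
have v1 : v.1 != 0.
  apply: contra v0 => /eqP v1; apply/eqP; apply: Z2_eqP => //.
  by move/eqP: uv; rewrite v1 mulr0 mulf_eq0 (negPf u1) => /eqP.
exists v.1, u.1; split => //.
apply: Z2_eqP; rewrite !(mulrz_fst, mulrz_snd); first ring.
by rewrite -uv mulrC.
Qed.

Section Decomposition.
Context {d : measure_display} {X : measurableType d} {R : realType}.
Variables (mu : probability X R) (act : Z2 -> X -> X).
Hypothesis hact : measure_preserving_action mu act.
Local Notation bm := bounded_measurable.
Implicit Types (f : X -> R).

Lemma act_invariant_mulrz f (v : Z2) (a : int) :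
  (forall x, f (act v x) = f x) -> forall x, f (act (v *~ a) x) = f x.
Proof.
move=> fv; have fn n x : f (act (v *+ n) x) = f x.
  elim: n x => [|n IH] x; first by rewrite mulr0n (act0 hact).
  by rewrite (act_mulrSn hact) fv IH.
case: a => n x; first by rewrite -pmulrn fn.
rewrite NegzE mulrNz -pmulrn.
by rewrite -(fn n.+1 (act (- (v *+ n.+1)) x)) (actKV hact).
Qed.

(** Parallel directions have a common nonzero multiple, along which both functions, hence their sum,
    are invariant; such functions are merged. *)
Lemma group_directions (s : seq Z2) (v : Z2 -> Z2) (phi : Z2 -> X -> R) :
  (forall g, g \in s -> v g != 0) -> (forall g, bm (phi g)) ->
  (forall g x, phi g (act (v g) x) = phi g x) ->
  exists (n : nat) (h : nat -> Z2) (psi : nat -> X -> R),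
  [/\ forall i, (i < n)%N -> h i != 0,
      forall i j, (i < n)%N -> (j < n)%N -> i != j -> detz (h i) (h j) != 0,
      forall i, bm (psi i),
      forall i, (i < n)%N -> forall x, psi i (act (h i) x) = psi i x &
      forall x, \sum_(g <- s) phi g x = \sum_(i < n) psi i x].
Proof.
move=> + bphi phiv; elim: s => [|g s IH] v0.
  exists 0%N, (fun=> 0), (fun _ _ => 0); split => //.
    by move=> i; exact: bm_cst.
  by move=> x; rewrite big_nil big_ord0.
have [g' g's|n [h [psi [h0 hdet bpsi psih psiE]]]] := IH.
  by apply: v0; rewrite inE g's orbT.
have vg0 : v g != 0 by apply: v0; rewrite inE eqxx.
have [[i /andP[i_n /eqP di]]|nopar] :=
    pselect (exists i, (i < n)%N && (detz (h i) (v g) == 0)).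
  have [a [b [a0 b0 e]]] := detz_eq0_common (h0 _ i_n) vg0 di.
  exists n, (fun j => if j == i then h i *~ a else h j),
    (fun j => if j == i then fun x => phi g x + psi i x else psi j); split.
  - move=> j jn; case: (eqVneq j i) => // _; [apply: mulrz_eq0_Z2 => //; exact: h0 | exact: h0].
  - move=> j k jn kn; case: (eqVneq j i) => [ej|ji]; case: (eqVneq k i) => [ek|ki]; rewrite ?ej ?ek.
    + by rewrite eqxx.
    + by move=> ik; rewrite detz_mulrzl mulf_neq0 ?hdet.
    + by move=> ij; rewrite detzC detz_mulrzl oppr_eq0 mulf_neq0 ?hdet// eq_sym.
    + exact: hdet.
  - by move=> j; case: (eqVneq j i) => // _; exact: bmD.
  - move=> j jn; case: (eqVneq j i) => [_|_] x; last exact: psih.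
    rewrite {1}e !act_invariant_mulrz//; exact: psih.
  - move=> x; rewrite big_cons psiE (bigD1 (Ordinal i_n))//=.
    rewrite [RHS](bigD1 (Ordinal i_n))//= eqxx addrA; congr (_ + _).
    by apply: eq_bigr => j ji; rewrite ifF//; apply/negbTE.
exists n.+1, (fun j => if j == n then v g else h j),
  (fun j => if j == n then phi g else psi j); split.
- move=> j; rewrite ltnS leq_eqVlt; case: (eqVneq j n) => //= _; exact: h0.
- have nd j : (j < n)%N -> detz (h j) (v g) != 0.
    by move=> jn; apply/negP => dj; apply: nopar; exists j; rewrite jn.
  move=> j k; rewrite !ltnS (leq_eqVlt j) (leq_eqVlt k).
  case: (eqVneq j n) => [ej|_]; case: (eqVneq k n) => [ek|_] //=; rewrite ?ej ?ek ?eqxx//.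
  + by move=> _ kn _; rewrite detzC oppr_eq0; exact: nd.
  + by move=> jn _ _; exact: nd.
  + exact: hdet.
- by move=> j; case: (eqVneq j n).
- move=> j; rewrite ltnS leq_eqVlt; case: (eqVneq j n) => //= _; exact: psih.
move=> x; rewrite big_cons psiE big_ord_recr /= eqxx addrC; congr (_ + _).
by apply: eq_bigr => j _; rewrite ifF// ltn_eqF.
Qed.

Lemma Ann_neq0 (A : set X) : Ann mu act \1_A <> [set laurent0] ->
  exists (p : laurent) (g0 : Z2), p g0 != 0 /\ Ann mu act \1_A p.
Proof.
move=> hA; apply: contrapT => hn; apply: hA; apply/seteqP; split => p /=.
  move=> pA; apply/fsfunP => g; rewrite fsfun0E.
  by apply: contrapT => /eqP pg; apply: hn; exists p, g.
move=> ->; rewrite /Ann /=; apply: aeW => x.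
by rewrite /laurent_act big1// => g _; rewrite fsfun0E mul0r.
Qed.

Lemma Ann_dilation (A : set X) (p : laurent) (g0 : Z2) :
  Ann mu act \1_A p -> exists2 N : nat, (0 < N)%N &
    {ae mu, forall x, forall k : nat,
      \sum_(g <- finsupp p) (p g)%:~R *
        \1_A (act ((g0 - g) *+ (k * N).+1) x) = 0 :> R}.
Proof.
move=> pA; pose B := (\sum_(g <- finsupp p) `|p g|).
(* With this factorial every prime factor of [k * N + 1] exceeds the sum [B] of the absolute values
   of the coefficients. *)
exists (`|B|%N)`!; first exact: fact_gt0.
apply: filterS (ae_orbit hact pA) => x hx k.
pose a (h : Z2) : int := (act h x \in A)%:R.
have ca h : conv_op (finsupp p) p (fun g => - g) a h = 0.
  apply: (@intr_inj R); rewrite rmorph0 -[RHS](hx h) /laurent_act /conv_op.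
  rewrite rmorph_sum /=; refine (eq_bigr _ _) => g _.
  by rewrite rmorphM /= indicE -(actD hact) addrC /a; case: (_ \in A).
have a1 h : `|a h| <= 1 by rewrite /a; case: (_ \in A).
set r := (k * _).+1.
have B0 : 0 <= B by apply: sumr_ge0.
have rp q : prime q -> (q %| r)%N -> \sum_(g <- finsupp p) `|p g| < q%:Z.
  move=> pq qr; rewrite ltNge; apply/negP => qB.
  have : (q %| `|B|%N`!)%N.
    rewrite dvdn_fact// prime_gt0//=.
    by rewrite -lez_nat abszE ger0_norm.
  move=> /(dvdn_mull k) qN; move: qr; rewrite /r -addn1 dvdn_addr// dvdn1.
  by move=> /eqP q1; rewrite q1 in pq.
(* Evaluating at [g0 *+ r] gives the [g0] term exponent zero, so that it does not depend on [r]. *)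
have := @conv_op_dilation _ _ (finsupp p) p (fun g => - g) a r isT rp a1 ca (g0 *+ r).
move/(congr1 (fun z : int => z%:~R : R)); rewrite /conv_op rmorph_sum rmorph0 /=.
move=> e; rewrite -[RHS]e; apply: eq_bigr => g _; rewrite rmorphM /= indicE; congr (_ * _).
by rewrite mulrnBl mulNrn /a; case: (_ \in A).
Qed.

(** As the dilation runs through [k * N + 1], the term of [g] follows an orbit of [(g0 - g) *+ N],
    so averaging over [k] replaces it by an invariant function. The term of [g0] does not move, and
    dividing by [p g0] expresses [\1_A] through the others. *)
Theorem Ann_decomposition (A : set X) : measurable A ->
  Ann mu act \1_A <> [set laurent0] ->
  exists (n : nat) (h : nat -> Z2) (psi : nat -> X -> R),
  [/\ forall i, (i < n)%N -> h i != 0,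
      forall i j, (i < n)%N -> (j < n)%N -> i != j -> detz (h i) (h j) != 0,
      forall i, bm (psi i),
      forall i, (i < n)%N -> forall x, psi i (act (h i) x) = psi i x &
      {ae mu, forall x, \1_A x = \sum_(i < n) psi i x}].
Proof.
move=> mA /Ann_neq0 [p [g0 [pg0 pA]]].
have [N N0 hN] := Ann_dilation g0 pA.
have bA : bm (\1_A : X -> R) by exact: bm_indic.
have bAg g : bm (fun x => \1_A (act (g0 - g) x) : R).
  exact: (bm_comp (act_measurable hact _) bA).
have /choice[phi phiP] : forall g : Z2, exists fs : X -> R, [/\ bm fs,
    forall x, fs (act ((g0 - g) *+ N) x) = fs x &
    {ae mu, forall x, ergodic_avg (act ((g0 - g) *+ N))
      (fun x => \1_A (act (g0 - g) x)) n x @[n --> \oo] --> fs x}].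
  move=> g.
  have [fs [h1 h2 _ h4]] := birkhoff (act_measurable hact ((g0 - g) *+ N))
    (act_preserving hact ((g0 - g) *+ N)) (bAg g).
  by exists fs.
pose s := [seq g <- finsupp p | g != g0].
pose c g : R := - (p g)%:~R / (p g0)%:~R.
have [|||n [h [psi [h0 hdet bpsi psih psiE]]]] :=
    @group_directions s (fun g => (g0 - g) *+ N) (fun g x => c g * phi g x).
- move=> g; rewrite mem_filter => /andP[gg0 _]; rewrite pmulrn.
  apply: mulrz_eq0_Z2; first by rewrite subr_eq0 eq_sym.
  by rewrite eqz_nat -lt0n.
- by move=> g; apply: bmZ; case: (phiP g).
- by move=> g x; have [_ -> _] := phiP g.
exists n, h, psi; split => //.
have phi_ae : {ae mu, forall x, forall g, ergodic_avg (act ((g0 - g) *+ N))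
      (fun x => \1_A (act (g0 - g) x)) n x @[n --> \oo] --> phi g x}.
  by apply: ae_countable => g; have [] := phiP g.
apply: filterS2 hN phi_ae => x hx cv; rewrite -psiE.
have sum0 : \sum_(g <- finsupp p) (p g)%:~R * phi g x = 0.
  have cvs : (\sum_(g <- finsupp p) (p g)%:~R * ergodic_avg
      (act ((g0 - g) *+ N)) (fun x => \1_A (act (g0 - g) x)) n x)
      @[n --> \oo] --> \sum_(g <- finsupp p) (p g)%:~R * phi g x.
    apply: cvg_big => [|g _]; first exact: add_continuous.
    exact: cvgMl_tmp.
  apply: (cvg_unique (@Rhausdorff R) cvs).
  rewrite (_ : (fun n => _) = (fun=> 0)); first exact: cvg_cst.
  apply/funext => m; rewrite /ergodic_avg.
  under eq_bigr do rewrite mulrA mulr_sumr.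
  rewrite -mulr_suml exchange_big /= big1 ?mul0r// => k _.
  rewrite -[RHS](hx k); apply: eq_bigr => g _; congr (_ * \1_A _).
  by rewrite (iter_act hact) -(actD hact) -mulrnA -mulrS mulnC.
have phi0 : phi g0 x = \1_A x.
  have := cv g0; rewrite subrr mul0rn => /(cvg_unique (@Rhausdorff R)); apply.
  rewrite (_ : (fun n => _) = (fun=> \1_A x)); first exact: cvg_cst.
  apply/funext => m; rewrite /ergodic_avg.
  under eq_bigr do rewrite (iter_act hact) mul0rn !(act0 hact).
  by rewrite sumr_const card_ord -[_ *+ _]mulr_natr mulfK ?pnatr_eq0.
have p0 : (p g0)%:~R != 0 :> R by rewrite intr_eq0.
rewrite big_filter -[\1_A x]phi0; apply: (mulfI p0).
have g0p : g0 \in finsupp p by rewrite mem_finsupp.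
move: sum0; rewrite (bigD1_seq g0)//= ?fset_uniq//.
move/eqP; rewrite addr_eq0 => /eqP ->; rewrite mulr_sumr -sumrN.
by apply: eq_bigr => g _; rewrite /c; field.
Qed.

End Decomposition.

(** * Components of sublattices *)

Definition sublattice (Q : nat) : {pred Z2} :=
  [pred g : Z2 | (Q%:Z %| g.1)%Z && (Q%:Z %| g.2)%Z].

Lemma sublatticeP (Q : nat) (g : Z2) :
  reflect (exists z : Z2, g = z *+ Q) (g \in sublattice Q).
Proof.
apply: (iffP andP) => [[/dvdzP[a ea] /dvdzP[b eb]]|[z ->]].
  by exists (a, b); apply: Z2_eqP;
    rewrite pmulrn ?mulrz_fst ?mulrz_snd.
by rewrite pmulrn mulrz_fst mulrz_snd !dvdz_mull.
Qed.

Lemma sublattice_zmod_closed (Q : nat) : zmod_closed (sublattice Q).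
Proof.
split; first by apply/sublatticeP; exists 0; rewrite mul0rn.
move=> _ _ /sublatticeP[a ->] /sublatticeP[b ->].
by apply/sublatticeP; exists (a - b); rewrite mulrnBl.
Qed.

Lemma sublattice_residue (Q : nat) (g : Z2) : (0 < Q)%N ->
  exists (i j : 'I_Q) (z : Z2), g = z *+ Q + ((i : nat)%:Z, (j : nat)%:Z).
Proof.
move=> Q0; have Qz : Q%:Z != 0 by rewrite eqz_nat -lt0n.
have h (a : int) : exists (i : 'I_Q) (b : int), a = b * Q%:Z + (i : nat)%:Z.
  have a0 : 0 <= (a %% Q%:Z)%Z by exact: modz_ge0.
  have aQ : (`|(a %% Q%:Z)%Z|%N < Q)%N.
    by rewrite -ltz_nat gez0_abs// ltz_mod.
  by exists (Ordinal aQ), (a %/ Q%:Z)%Z; rewrite /= gez0_abs// -divz_eq.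
have [i [a ea]] := h g.1; have [j [b eb]] := h g.2.
exists i, j, (a, b); apply: Z2_eqP; rewrite /= pmulrn ?mulrz_fst ?mulrz_snd.
  by [].
by [].
Qed.

Lemma sublattice_finite_index (Q : nat) : (0 < Q)%N ->
  finite_index (sublattice Q).
Proof.
move=> Q0; pose F (p : 'I_Q * 'I_Q) : set Z2 :=
  [set ((p.1 : nat)%:Z, (p.2 : nat)%:Z) + h | h in [set` sublattice Q]].
apply: (@sub_finite_set _ _ (F @` setT)); last first.
  exact/finite_image/finite_finset.
move=> _ [g _ <-]; have [i [j [z ->]]] := sublattice_residue g Q0.
exists (i, j) => //; rewrite /F; apply/seteqP; split => _ [h /= hL <-].
  move/sublatticeP: hL => [y ->]; exists ((y - z) *+ Q).
    by apply/sublatticeP; exists (y - z).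
  by rewrite mulrnBl; ring.
move/sublatticeP: hL => [y ->]; exists ((y + z) *+ Q).
  by apply/sublatticeP; exists (y + z).
by rewrite mulrnDl; ring.
Qed.

Section Components.
Context {d : measure_display} {X : measurableType d} {R : realType}.
Variables (mu : probability X R) (act : Z2 -> X -> X).
Hypothesis hact : measure_preserving_action mu act.
Hypothesis herg : ergodic_action mu act.
Local Notation bm := bounded_measurable.
Local Notation J := (expect mu).
Implicit Types (f : X -> R) (E F : set X).

Lemma fixes_mod_nullP (g : Z2) E :
  fixes_mod_null mu act g E <-> {ae mu, forall x, E (act (- g) x) <-> E x}.
Proof.
have e : (act g @` E) `+` E = ~` [set x | E (act (- g) x) <-> E x].
  have im x : (act g @` E) x <-> E (act (- g) x).
    split=> [[y Ey <-]|Ex]; first by rewrite (actK hact).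
    by exists (act (- g) x) => //; rewrite (actKV hact).
  apply/seteqP; split => x /=.
    move=> [[/im h nE] [a b]|[Ex ni] [a b]]; first exact: nE (a h).
    by apply: ni; apply/im; exact: b.
  move=> ne; have [Ex|nEx] := pselect (E x).
    right; split => // /im h; apply: ne; split => //.
  left; split => //; apply/im; apply: contrapT => h; apply: ne; split => //.
by rewrite /fixes_mod_null e.
Qed.

(** One null set serves all [z], as the lattice is countable; arguments along orbits need this
    form. *)
Definition lattice_inv (Q : nat) E : Prop :=
  {ae mu, forall x, forall z : Z2, E (act (z *+ Q) x) <-> E x}.

Lemma invariant_setsP (Q : nat) E :
  invariant_sets mu act (sublattice Q) E <-> measurable E /\ lattice_inv Q E.
Proof.
split=> -[mE h]; split => //.
  apply: (@ae_countable _ _ _ mu _ (fun (z : Z2) x => _)) => z.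
  have := (fixes_mod_nullP (- (z *+ Q)) E).1; rewrite opprK; apply.
  by apply: h; apply/sublatticeP; exists (- z); rewrite mulNrn.
move=> _ /sublatticeP[z ->]; apply/fixes_mod_nullP.
by move: h; rewrite /lattice_inv; apply: filterS => x /(_ (- z)); rewrite mulNrn.
Qed.

Lemma lattice_inv_dvd (Q Q' : nat) E : (Q %| Q')%N ->
  lattice_inv Q E -> lattice_inv Q' E.
Proof.
move=> /dvdnP[k ->]; rewrite /lattice_inv; apply: filterS => x h z.
by rewrite mulrnA; exact: h.
Qed.

Lemma lattice_inv_orbit (Q : nat) E : lattice_inv Q E ->
  {ae mu, forall x, forall (g z : Z2), E (act (z *+ Q) (act g x)) <-> E (act g x)}.
Proof. by move=> /(ae_orbit hact). Qed.

Lemma lattice_invI (Q : nat) E F : lattice_inv Q E -> lattice_inv Q F ->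
  lattice_inv Q (E `&` F).
Proof.
by rewrite /lattice_inv; apply: filterS2 => x hE hF z;
  split => -[/hE ? /hF ?].
Qed.

Lemma lattice_invD (Q : nat) E F : lattice_inv Q E -> lattice_inv Q F ->
  lattice_inv Q (E `\` F).
Proof.
rewrite /lattice_inv; apply: filterS2 => x hE hF z; split => -[/hE ? nF]; split => //;
  by move=> /hF.
Qed.

Lemma lattice_inv_of_fun (Q : nat) E f (S : set R) : lattice_inv Q E ->
  {ae mu, forall x, E x -> forall z : Z2, f (act (z *+ Q) x) = f x} ->
  lattice_inv Q (E `&` f @^-1` S).
Proof.
rewrite /lattice_inv; apply: filterS2 => x hE hf z; split => -[Ex fx].
  have {}Ex := (hE z).1 Ex; split => //.
  by move: fx; rewrite /= hf.
by split; [exact/hE | rewrite /= hf].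
Qed.

Lemma ae_notP E : measurable E -> mu E = 0%E <-> {ae mu, forall x, ~ E x}.
Proof.
move=> mE; split=> [/(negligibleP _ mE)|] [N [mN N0 EN]].
  by exists N; split => // x /= h; apply: EN; apply: contrapT.
apply/(negligibleP _ mE); exists N; split => // x Ex; apply: EN => /=.
by move=> /(_ Ex).
Qed.

Lemma muE E : measurable E -> mu E = (fine (mu E))%:E.
Proof. by move=> mE; rewrite fineK// fin_num_measure. Qed.

Lemma expect_gt0_sum_nat (n : nat) (F : 'I_n -> set X) :
  (forall i, measurable (F i)) -> {ae mu, forall x, exists i, F i x} ->
  1 <= \sum_(i < n) fine (mu (F i)).
Proof.
move=> mF aF; rewrite -[leLHS](expect_cst mu).
under eq_bigr do rewrite -expect_indic//.
have bF i : bm (\1_(F i) : X -> R) by exact: bm_indic.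
rewrite -expect_sum//; apply: le_expect_ae; [exact: bm_cst|exact: bm_sum|].
apply: filterS aF => x [i Fx]; rewrite (bigD1 i)//= indicE mem_set//.
by rewrite lerDl sumr_ge0// => j _; rewrite indicE.
Qed.

(* The [Q * Q] translates of [E] by coset representatives cover an invariant
   set of positive mass, hence almost everything. *)
Lemma lattice_inv_lb (Q : nat) E : (0 < Q)%N -> measurable E ->
  lattice_inv Q E -> mu E != 0%E -> 1 <= (Q * Q)%:R * fine (mu E).
Proof.
move=> Q0 mE iE E0.
pose r (p : 'I_Q * 'I_Q) : Z2 := ((p.1 : nat)%:Z, (p.2 : nat)%:Z).
have mpre p : measurable (act (r p) @^-1` E).
  by rewrite -[X in measurable X]setTI; apply: (act_measurable hact).
pose n := #|{: 'I_Q * 'I_Q}|.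
pose F (k : 'I_n) := act (r (enum_val k)) @^-1` E.
pose U := \bigcup_(k in [set: 'I_n]) F k.
have mU : measurable U.
  apply: fin_bigcup_measurable => [|k _]; last exact: mpre.
  exact: finite_finset.
have UE : {ae mu, forall x, forall g : Z2, U (act g x) <-> exists g, E (act g x)}.
  apply: filterS (lattice_inv_orbit iE) => x h g; split.
    by move=> [k _]; rewrite /F /= -(actD hact); exists (r (enum_val k) + g).
  move=> [g']; have [i [j [z]]] := sublattice_residue (g' - g) Q0.
  move/eqP; rewrite subr_eq => /eqP ->.
  rewrite -addrA (actD hact) => /h Ex.
  exists (enum_rank (i, j)) => //; rewrite /F /= enum_rankK /r /=.
  by rewrite -(actD hact).
have [U0|U1] : mu U = 0%E \/ mu U = 1%E.
- apply: herg => // g; apply/fixes_mod_nullP.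
  apply: filterS UE => x h; rewrite h -{2}(act0 hact x) h //.
- exfalso; move/negP: E0; apply; apply/eqP/ae_notP => //.
  apply: filterS2 ((ae_notP mU).1 U0) UE => x nU h Ex; apply: nU.
  rewrite -(act0 hact x) h.
  by exists 0; rewrite (act0 hact).
have aU : {ae mu, forall x, exists k, F k x}.
  have : mu (~` U) = 0%E by rewrite probability_setC// U1 subee.
  move=> h; exists (~` U); split => //; first exact: measurableC.
  by move=> x /= nx [k _ Fx]; apply: nx; exists k.
have := expect_gt0_sum_nat (fun k => mpre _) aU.
have -> : \sum_(k < n) fine (mu (F k)) = \sum_(k < n) fine (mu E).
  by apply: eq_bigr => k _; rewrite (act_preserving hact).
by rewrite sumr_const card_ord /n card_prod card_ord mulr_natl.
Qed.

Lemma component_sub (Q : nat) E : ergodic_component mu act (sublattice Q) E ->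
  [/\ measurable E, lattice_inv Q E & mu E != 0%E].
Proof. by move=> [/invariant_setsP[mE iE] E0 _]. Qed.

Lemma fine_muD E F : measurable E -> measurable F -> F `<=` E ->
  fine (mu (E `\` F)) = fine (mu E) - fine (mu F).
Proof.
move=> mE mF FE; have mD : measurable (E `\` F) by exact: measurableD.
rewrite -!expect_indic// -expectB; try exact: bm_indic.
congr expect; apply/funext => x; rewrite !indicE in_setD.
case: (boolP (x \in F)) => [/set_mem/FE Ex|_] /=.
  by rewrite mem_set// subrr.
by rewrite andbT subr0.
Qed.

Lemma fine_mu_neq0 E : measurable E -> mu E != 0%E -> fine (mu E) != 0.
Proof. by move=> mE; rewrite {1}(muE mE) eqe. Qed.

(** Splitting terminates because each invariant part of positive measure uses at least one unit of
    [(Q * Q)%:R * fine (mu E)], so both parts have a smaller bound [n]. *)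
Lemma component_cover (Q n : nat) E : (0 < Q)%N -> measurable E ->
  lattice_inv Q E -> (Q * Q)%:R * fine (mu E) < n%:R ->
  exists (k : nat) (c : nat -> set X),
    (forall i, (i < k)%N ->
      ergodic_component mu act (sublattice Q) (c i) /\ c i `<=` E) /\
    {ae mu, forall x, E x -> exists2 i, (i < k)%N & c i x}.
Proof.
move=> Q0; elim: n E => [|n IH] E mE iE.
  by rewrite ltNge mulr_ge0// fine_ge0.
move=> En; have [E0|E0] := eqVneq (mu E) 0%E.
  exists 0%N, (fun=> set0); split => //.
  by apply: filterS ((ae_notP mE).1 E0) => x.
have [Ec|nEc] := pselect (ergodic_component mu act (sublattice Q) E).
  exists 1%N, (fun=> E); split; first by move=> i _; split.
  by apply: aeW => x Ex; exists 0%N.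
have [F [mF iF FE F0 FnE]] : exists F, [/\ measurable F, lattice_inv Q F,
    F `<=` E, mu F != 0%E & mu F != mu E].
  apply: contrapT => hn; apply: nEc; split => //; first exact/invariant_setsP.
  move=> F /invariant_setsP[mF iF] FE; have [F0|F0] := eqVneq (mu F) 0%E.
    by left.
  right; apply: contrapT => /eqP FnE; apply: hn; exists F; split => //.
have mD : measurable (E `\` F) by exact: measurableD.
have iD := lattice_invD iE iF.
have eD := fine_muD mE mF FE.
have D0 : mu (E `\` F) != 0%E.
  rewrite (muE mD) eqe eD subr_eq0; apply: contra FnE => /eqP e.
  by rewrite (muE mE) (muE mF) e.
have lF := lattice_inv_lb Q0 mF iF F0.
have lD := lattice_inv_lb Q0 mD iD D0.
have [|k1 [c1 [h1 a1]]] := IH F mF iF.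
  by move: En lD; rewrite eD -natr1; lra.
have [|k2 [c2 [h2 a2]]] := IH _ mD iD.
  by move: En lF; rewrite eD -natr1; lra.
exists (k1 + k2)%N, (fun i => if (i < k1)%N then c1 i else c2 (i - k1)%N).
split.
  move=> i ik; case: ifP => [ik1|ik1].
    by have [? s] := h1 _ ik1; split => //; exact: subset_trans s FE.
  have [|? s] := h2 (i - k1)%N.
    by rewrite ltn_subLR// leqNgt ik1.
  by split => //; apply: subset_trans s _; exact: subDsetl.
apply: filterS2 a1 a2 => x x1 x2 Ex; have [Fx|nFx] := pselect (F x).
  have [i ik ci] := x1 Fx; exists i; last by rewrite ik.
  by rewrite (leq_trans ik)// leq_addr.
have [//|i ik ci] := x2 _; exists (k1 + i)%N; first by rewrite ltn_add2l.
by rewrite ltnNge leq_addr /= addKn.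
Qed.

Lemma component_dichotomy (Q : nat) E F :
  ergodic_component mu act (sublattice Q) E -> measurable F ->
  lattice_inv Q F ->
  {ae mu, forall x, E x -> ~ F x} \/ {ae mu, forall x, E x -> F x}.
Proof.
move=> cE mF iF; have [mE iE E0] := component_sub cE.
have [_ _ hE] := cE; have mFE : measurable (F `&` E) by exact: measurableI.
have [||F0|FE] := hE (F `&` E).
- by apply/invariant_setsP; split => //; exact: lattice_invI.
- exact: subIsetr.
- left; apply: filterS ((ae_notP mFE).1 F0) => x nFE Ex Fx.
  by apply: nFE.
right; have mD : measurable (E `\` (F `&` E)) by exact: measurableD.
have D0 : mu (E `\` (F `&` E)) = 0%E.
  by rewrite (muE mD) fine_muD// FE subrr.
apply: filterS ((ae_notP mD).1 D0) => x nD Ex; apply: contrapT => nF.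
by apply: nD; split => // -[].
Qed.

Lemma ae_exists E (P : X -> Prop) : measurable E -> mu E != 0%E ->
  {ae mu, forall x, E x -> P x} -> exists2 x, E x & P x.
Proof.
move=> mE E0 [N [mN N0 PN]]; apply: contrapT => hn; move/negP: E0; apply.
apply/eqP/negligibleP => //; exists N; split => // x Ex; apply: PN => /= h.
by apply: hn; exists x => //; exact: h.
Qed.

(** Take [c] to be the mean of [f] on [E]. The invariant set where [f < c] is null or full in [E],
    so [f - c] has a constant sign there and mean zero. *)
Lemma component_constant (Q : nat) E f :
  ergodic_component mu act (sublattice Q) E -> bm f ->
  {ae mu, forall x, E x -> forall z : Z2, f (act (z *+ Q) x) = f x} ->
  exists c : R, {ae mu, forall x, E x -> f x = c}.
Proof.
move=> cE bf fz; have [mE iE E0] := component_sub cE.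
have m0 := fine_mu_neq0 mE E0.
have bi := bm_indic mE (R := R).
have bif : bm (fun x => \1_E x * f x) by exact: bmM.
pose c := J (fun x => \1_E x * f x) / fine (mu E); exists c.
have bic : bm (fun x => c * \1_E x) by exact: bmZ.
have Jc : J (fun x => \1_E x * f x) - J (fun x => c * \1_E x) = 0.
  by rewrite expectZ// expect_indic// /c divfK// subrr.
have mS : measurable (E `&` f @^-1` `]-oo, c[).
  apply: measurableI => //; rewrite -[X in measurable X]setTI.
  by apply: bf.1.
have sol g : bm g -> {ae mu, forall x, 0 <= g x} -> J g = 0 ->
    {ae mu, forall x, g x = \1_E x * f x - c * \1_E x \/
      g x = c * \1_E x - \1_E x * f x} ->
    {ae mu, forall x, E x -> f x = c}.
  move=> bg g0 Jg ge; have g00 : {ae mu, forall x, g x = 0}.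
    by apply: expect_ge0_eq0 => //; rewrite Jg.
  apply: filterS2 g00 ge => x gx [e|e] Ex; move: gx; rewrite e indicE mem_set//;
    rewrite mul1r mulr1; lra.
have [h|h] := component_dichotomy cE mS (lattice_inv_of_fun _ iE fz).
  apply: (sol (fun x => \1_E x * f x - c * \1_E x)); first exact: bmB.
  - apply: filterS h => x h; rewrite indicE; case: (boolP (x \in E)) => [|_].
      move/set_mem => Ex; have := h Ex; rewrite /= in_itv /=.
      move=> /not_andP[//|/negP]; rewrite -leNgt; lra.
    by rewrite mul0r mulr0 subrr.
  - by rewrite expectB.
  - by apply: aeW => x; left.
apply: (sol (fun x => c * \1_E x - \1_E x * f x)); first exact: bmB.
- apply: filterS h => x h; rewrite indicE; case: (boolP (x \in E)) => [|_].
    move/set_mem => Ex; have [_] := h Ex; rewrite /= in_itv /=; lra.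
  by rewrite mul0r mulr0 subrr.
- by rewrite expectB// -opprB Jc oppr0.
- by apply: aeW => x; right.
Qed.

(** [cos1] and [sin1] turn invariance modulo 1 into invariance of bounded functions, and together
    they determine [f] modulo 1. *)
Lemma component_constant_mod1 (Q : nat) E f :
  ergodic_component mu act (sublattice Q) E -> measurable_fun [set: X] f ->
  {ae mu, forall x, E x -> forall z : Z2,
    f (act (z *+ Q) x) - f x \is a Num.int} ->
  exists c : R, {ae mu, forall x, E x -> f x - c \is a Num.int}.
Proof.
move=> cE mf fz; have [mE iE E0] := component_sub cE.
have mpif : measurable_fun [set: X] (fun x => 2 * pi * f x).
  exact: measurable_funM.
have [|a ha] := component_constant cE (bm_cos mpif).
  by apply: filterS fz => x h Ex z; apply: cos1_eq_int; exact: h.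
have [|b hb] := component_constant cE (bm_sin mpif).
  by apply: filterS fz => x h Ex z; apply: sin1_eq_int; exact: h.
have hab : {ae mu, forall x, E x -> cos1 (f x) = a /\ sin1 (f x) = b}.
  by apply: filterS2 ha hb => x h1 h2 Ex; split; [exact: h1|exact: h2].
have [x0 Ex0 [e1 e2]] := ae_exists mE E0 hab.
exists (f x0); apply: filterS hab => x h Ex; apply: cos1_eq1.
have [h1 h2] := h Ex.
by rewrite cos1B h1 h2 -e1 -e2 -!expr2 cos1_sin1_sq.
Qed.

End Components.

(** * Rational and irrational components *)

Lemma common_multiple (k : nat) (P : nat -> nat -> Prop) :
  (forall i, (i < k)%N -> exists2 q, (0 < q)%N &
    forall Q, (q %| Q)%N -> P i Q) ->
  exists2 q, (0 < q)%N & forall Q, (q %| Q)%N -> forall i, (i < k)%N -> P i Q.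
Proof.
elim: k => [|k IH] h; first by exists 1%N.
have [|q1 q10 h1] := IH; first by move=> i ik; apply: h; exact: ltnW.
have [q2 q20 h2] := h k (leqnn _).
exists (q1 * q2)%N; first by rewrite muln_gt0 q10.
move=> Q qQ i; rewrite ltnS leq_eqVlt => /orP[/eqP ->|ik].
  by apply: h2; apply: dvdn_trans qQ; exact: dvdn_mull.
by apply: h1 => //; apply: dvdn_trans qQ; exact: dvdn_mulr.
Qed.

Lemma irrational_mod1M {R : realType} (a : R) (k : nat) :
  (0 < k)%N -> irrational_mod1 a -> irrational_mod1 (a *+ k).
Proof. by move=> k0 ia n n0; rewrite -mulrnA; apply: ia; rewrite muln_gt0 k0. Qed.

Section Dichotomy.
Context {d : measure_display} {X : measurableType d} {R : realType}.
Variables (mu : probability X R) (act : Z2 -> X -> X).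
Hypothesis hact : measure_preserving_action mu act.
Hypothesis herg : ergodic_action mu act.
Local Notation component Q := (ergodic_component mu act (sublattice Q)).
Local Notation lattice_inv := (lattice_inv mu act).
Local Notation diffop := (diffop act).
Implicit Types (f : X -> R) (E : set X).

Lemma diffop_invariant f (h v : Z2) : (forall x, f (act h x) = f x) ->
  forall x, diffop v f (act h x) = diffop v f x.
Proof. by move=> fh x; rewrite /diffop (actC hact) !fh. Qed.

Lemma iter_diffop_invariant n f (h v : Z2) : (forall x, f (act h x) = f x) ->
  forall x, iter n (diffop v) f (act h x) = iter n (diffop v) f x.
Proof.
move=> fh; elim: n => //= n IH; exact: diffop_invariant.
Qed.

Lemma lattice_inv_act Q E : lattice_inv Q E ->
  {ae mu, forall x, E x -> forall z : Z2, E (act (z *+ Q) x)}.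
Proof. by rewrite /lattice_inv; apply: filterS => x h Ex z; exact/h. Qed.

Lemma mod1_invariant_mulrz Q E f (w : Z2) : lattice_inv Q E ->
  {ae mu, forall x, E x -> diffop (w *+ Q) f x \is a Num.int} ->
  {ae mu, forall x, E x -> forall b : int,
    f (act ((w *+ Q) *~ b) x) - f x \is a Num.int}.
Proof.
move=> iE /(ae_orbit hact) fE.
have /(ae_orbit hact) aE := lattice_inv_act iE.
apply: filterS2 fE aE => x hf hE Ex.
have pos (m : nat) (y : Z2) : E (act y x) ->
    diffop ((w *+ Q) *+ m) f (act y x) \is a Num.int.
  move=> Ey; rewrite (diffop_mulrn hact) rpred_sum// => i _.
  rewrite -(actD hact); apply: hf; rewrite (actD hact) -mulrnA mulnC mulrnA.
  exact: hE.
case=> m; first by have := pos m 0; rewrite (act0 hact); apply.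
rewrite NegzE mulrNz -pmulrn.
have := pos m.+1 (- ((w *+ Q) *+ m.+1)) => h.
rewrite -opprB rpredN.
have := h _; rewrite /diffop (actKV hact); apply.
have := hE 0; rewrite (act0 hact) => /(_ Ex (- (w *+ m.+1))).
by rewrite mulNrn -!mulrnA mulnC.
Qed.

(** By Cramer's rule the vectors of the sparser lattice are combinations of [h], which fixes [f],
    and of [w *+ Q], which changes [f] by integers on [E]. *)
Lemma mod1_invariant_sublattice Q E f (h w : Z2) : lattice_inv Q E ->
  (forall x, f (act h x) = f x) ->
  {ae mu, forall x, E x -> diffop (w *+ Q) f x \is a Num.int} ->
  {ae mu, forall x, E x -> forall z : Z2,
    f (act (z *+ (Q * `|detz h w|)) x) - f x \is a Num.int}.
Proof.
move=> iE fh /(mod1_invariant_mulrz iE); apply: filterS => x fx Ex z.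
have [a [b e]] : exists a b : int,
    z *+ (Q * `|detz h w|) = h *~ a + (w *+ Q) *~ b.
  have [s es] : exists s : int, (`|detz h w|%N)%:Z = detz h w * s.
    have [le0|le0] := leP 0 (detz h w).
      by exists 1; rewrite mulr1 gez0_abs.
    by exists (-1); rewrite mulrN1 ltz0_abs.
  exists (detz z w * s * Q%:Z), (detz h z * s).
  rewrite mulnC mulrnA [z *+ _]pmulrn es mulrzA detz_cramer.
  by apply: Z2_eqP; rewrite /= !pmulrn /= ?(mulrz_fst, mulrz_snd) /=
    ?(mulrz_fst, mulrz_snd); ring.
by rewrite e (actD hact) (act_invariant_mulrz hact)//; exact: fx.
Qed.

Definition good_component Q E f (w : Z2) : Prop :=
  (exists c : R, {ae mu, forall x, E x -> f x - c \is a Num.int}) \/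
  (exists (n : nat) (a : R), irrational_mod1 a /\
    {ae mu, forall x, E x -> iter n.+1 (diffop (w *+ Q)) f x - a \is a Num.int}).

(* By ergodicity the top difference of [f] is constant modulo 1 on components.
   If the constant is rational with denominator [q], passing from [Q] to a
   multiple of [q * Q] lowers the degree of the phase [f]. *)
Lemma phase_dichotomy f (h w : Z2) n Q E :
  detz h w != 0 -> measurable_fun [set: X] f ->
  (forall x, f (act h x) = f x) ->
  (0 < Q)%N -> measurable E -> lattice_inv Q E ->
  {ae mu, forall x, E x -> iter n (diffop (w *+ Q)) f x \is a Num.int} ->
  exists2 Q1, (0 < Q1)%N & forall Q', (Q1 %| Q')%N -> (0 < Q')%N ->
    forall E', component Q' E' -> {ae mu, forall x, E' x -> E x} ->
    good_component Q' E' f w.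
Proof.
move=> hw mf fh; elim: n Q E => [|n IH] Q E Q0 mE iE fE.
  exists 1%N => // Q' _ _ E' _ E'E; left; exists 0.
  by apply: filterS2 fE E'E => x h1 h2 /h2 /h1; rewrite subr0.
pose b := iter n (diffop (w *+ Q)) f.
have mb : measurable_fun [set: X] b by exact: (measurable_iter_diffop hact).
have bh : forall x, b (act h x) = b x by exact: iter_diffop_invariant.
have bE : {ae mu, forall x, E x -> diffop (w *+ Q) b x \is a Num.int} by exact: fE.
have bw := mod1_invariant_mulrz iE bE.
pose D := `|detz h w|%N; pose Q2 := (Q * D)%N.
have D0 : (0 < D)%N by rewrite absz_gt0.
have Q20 : (0 < Q2)%N by rewrite muln_gt0 Q0.
have QQ2 : (Q %| Q2)%N by exact: dvdn_mulr.
have iE2 := lattice_inv_dvd QQ2 iE.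
have bound : (Q2 * Q2)%:R * fine (mu E) <
    (Num.bound ((Q2 * Q2)%:R * fine (mu E)))%:R.
  by apply: archi_boundP; rewrite mulr_ge0// fine_ge0.
have [k [c [hc cov]]] := component_cover hact herg Q20 mE iE2 bound.
pose P i Q' := (0 < Q')%N -> forall E', component Q' E' ->
  {ae mu, forall x, E' x -> c i x} -> good_component Q' E' f w.
have [|Q1 Q10 hQ1] := @common_multiple k P.
  move=> i ik; have [ci ciE] := hc i ik.
  have [mc ic c0] := component_sub hact ci.
  have [|a ha] := component_constant_mod1 hact ci mb.
    apply: filterS (mod1_invariant_sublattice iE bh bE) => x h1 cx.
    exact: h1 (ciE _ cx).
  have ham : {ae mu, forall x, c i x -> forall m : nat,
      iter n (diffop (w *+ Q)) f (act ((w *+ Q) *+ m) x) - a \is a Num.int}.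
    apply: filterS2 bw ha => x h1 h2 cx m.
    have := rpredD (h1 (ciE _ cx) m) (h2 cx).
    by rewrite addrA subrK pmulrn.
  have scale t : {ae mu, forall x, c i x ->
      iter n (diffop (w *+ (Q * t))) f x - a *+ (t ^ n) \is a Num.int}.
    apply: filterS ham => x h1 cx.
    have := iter_diffop_mulrn hact t (h1 cx) 0.
    by rewrite mulr0n (act0 hact) -mulrnA.
  have [n0|n0] := posnP n.
    exists 1%N => // Q' _ _ E' _ E'c; left; exists a.
    move: ha; rewrite /b n0 => ha.
    by apply: filterS2 ha E'c => x h1 h2 /h2 /h1.
  (* Passing to the modulus [t * Q2] multiplies the constant by [(D * t) ^ n], which keeps it
     irrational. *)
  have [ira|nira] := pselect (irrational_mod1 a).
    exists Q2 => // Q' /dvdnP[t ->] Q'0 E' _ E'c; right.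
    exists n.-1, (a *+ ((D * t) ^ n)); split.
      apply: irrational_mod1M => //; rewrite expn_gt0 muln_gt0 D0 /=.
      by move: Q'0; rewrite muln_gt0 => /andP[->].
    rewrite (prednK n0).
    apply: filterS2 (scale (D * t)%N) E'c => x h1 h2 /h2 /h1.
    by rewrite mulnA [(t * Q2)%N]mulnC.
  have /existsPNP[q q0 /negP/negPn aq] : ~ (forall q, (0 < q)%N ->
      a *+ q \isn't a Num.int) by [].
  (* If [a *+ q] is an integer, so is [a *+ ((D * q) ^ n)], because [n > 0]; hence [n] differences
     along the new multiple already give integers. The factor [D] keeps the new lattice inside the
     one that preserves [c i]. *)
  apply: (IH (Q * (D * q))%N (c i)) => //.
  - by rewrite !muln_gt0 Q0 D0.
  - apply: lattice_inv_dvd ic; rewrite mulnA; exact: dvdn_mulr.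
  apply: filterS (scale (D * q)%N) => x h1 cx.
  have : a *+ ((D * q) ^ n) \is a Num.int.
    by rewrite -(prednK n0) expnS -mulnA mulnCA mulrnA rpredMn.
  by move=> h2; have := rpredD (h1 cx) h2; rewrite subrK.
exists (Q2 * Q1)%N; first by rewrite muln_gt0 Q20.
move=> Q' hQ' Q'0 E' cE' E'E.
have Q1Q' : (Q1 %| Q')%N by apply: dvdn_trans hQ'; exact: dvdn_mull.
have Q2Q' : (Q2 %| Q')%N by apply: dvdn_trans hQ'; exact: dvdn_mulr.
(* Up to null sets, a component of a finer lattice lies in one of the [c i] or misses them all; the
   latter is impossible since they cover [E]. *)
have [[i [ik E'c]]|none] := pselect (exists i, (i < k)%N /\
    {ae mu, forall x, E' x -> c i x}).
  exact: (hQ1 _ Q1Q' _ ik).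
have [mE' _ E'0] := component_sub hact cE'.
exfalso; move/eqP: E'0; apply; apply/(ae_notP mu mE').
have : {ae mu, forall x, forall i, (i < k)%N -> E' x -> ~ c i x}.
  apply: ae_countable => i; have [ik|ik] := ltnP i k; last by exact: aeW.
  have [ci _] := hc i ik; have [mc ic _] := component_sub hact ci.
  have [h1|h1] := component_dichotomy hact cE' mc (lattice_inv_dvd Q2Q' ic).
    by apply: filterS h1 => x h1 _.
  by exfalso; apply: none; exists i.
apply: filterS3 cov E'E => x h1 h2 h3 Ex.
by have [i ik ci] := h1 (h2 Ex); exact: h3 ik Ex ci.
Qed.

End Dichotomy.

(** * Proof of the theorem *)

Section Assembly.
Context {d : measure_display} {X : measurableType d} {R : realType}.
Variables (mu : probability X R) (act : Z2 -> X -> X).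
Hypothesis hact : measure_preserving_action mu act.
Hypothesis herg : ergodic_action mu act.
Local Notation bm := bounded_measurable.
Local Notation J := (expect mu).
Local Notation component Q := (ergodic_component mu act (sublattice Q)).
Local Notation lattice_inv := (lattice_inv mu act).
Local Notation diffop := (diffop act).
Implicit Types (f : X -> R) (E : set X).

Definition diffop_prod (u : nat -> Z2) (s : seq nat) f : X -> R :=
  foldr (fun j g => diffop (u j) g) f s.

Lemma diffop_prod_invariant u s f (h : Z2) : (forall x, f (act h x) = f x) ->
  forall x, diffop_prod u s f (act h x) = diffop_prod u s f x.
Proof.
move=> fh; elim: s => //= j s IH; exact: (diffop_invariant hact).
Qed.

Lemma diffop_prod_eq0 u s f j : j \in s ->
  (forall x, f (act (u j) x) = f x) -> forall x, diffop_prod u s f x = 0.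
Proof.
move=> + fj; elim: s => //= k s IH; rewrite inE => /orP[/eqP <-|js] x.
  by rewrite /diffop (diffop_prod_invariant u s fj) subrr.
by rewrite /diffop !IH// subrr.
Qed.

(** For functions invariant along [h] only the class of a direction modulo multiples of [h]
    matters. *)
Lemma diffop_prod_iter u s f (h w : Z2) : (forall x, f (act h x) = f x) ->
  (forall j, j \in s -> exists b : int, w = u j + h *~ b) ->
  forall x, diffop_prod u s f x = iter (size s) (diffop w) f x.
Proof.
move=> fh; elim: s => //= j s IH us x.
have {}IH y : diffop_prod u s f y = iter (size s) (diffop w) f y.
  by apply: IH => k ks; apply: us; rewrite inE ks orbT.
have [b e] : exists b : int, w = u j + h *~ b by apply: us; rewrite inE eqxx.
change (diffop_prod u s f (act (u j) x) - diffop_prod u s f x =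
  iter (size s) (diffop w) f (act w x) - iter (size s) (diffop w) f x).
rewrite !IH; congr (_ - _).
have -> : act w x = act (h *~ b) (act (u j) x) by rewrite e addrC (actD hact).
rewrite (act_invariant_mulrz hact)//.
exact: (iter_diffop_invariant hact).
Qed.

Lemma diffop_prod_sum u s f (n : nat) (F : nat -> X -> R) x :
  (forall g, f (act g x) = \sum_(i < n) F i (act g x)) ->
  forall g, diffop_prod u s f (act g x) =
    \sum_(i < n) diffop_prod u s (F i) (act g x).
Proof.
move=> fF; elim: s => //= j s IH g.
rewrite /diffop -(actD hact) !IH -sumrB; apply: eq_bigr => i _.
by rewrite (actD hact).
Qed.

Lemma diffop_prod_int u s f : (forall x, f x \is a Num.int) ->
  forall x, diffop_prod u s f x \is a Num.int.
Proof. by move=> fi; elim: s => //= j s IH x; rewrite rpredB. Qed.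

Lemma iter_diffop_affine n w f (a c : R) x :
  iter n.+1 (diffop w) (fun x => a * f x + c) x =
  a * iter n.+1 (diffop w) f x.
Proof.
elim: n x => [|n IH] x; first by rewrite /= /diffop; ring.
by rewrite iterS /diffop !IH [in RHS]iterS /diffop; ring.
Qed.

Lemma iter_diffop_eq n w f1 f2 x :
  (forall g : Z2, f1 (act w (act g x)) - f2 (act w (act g x)) =
    f1 (act g x) - f2 (act g x)) ->
  forall g, iter n.+1 (diffop w) f1 (act g x) = iter n.+1 (diffop w) f2 (act g x).
Proof.
move=> h; elim: n => [|n IH] g.
  by rewrite /= /diffop; have := h g; lra.
by rewrite iterS /diffop -(actD hact) !IH [in RHS]iterS /diffop -(actD hact).
Qed.

(** Averages inherit invariance along [h j] only on almost every orbit, so the hypothesis concerns a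
    single orbit. *)
Lemma orbit_invariant_mulrz f (v : Z2) x :
  (forall g : Z2, f (act v (act g x)) = f (act g x)) ->
  forall (a : int) (g : Z2), f (act (v *~ a) (act g x)) = f (act g x).
Proof.
move=> fv; have fn n g : f (act (v *+ n) (act g x)) = f (act g x).
  elim: n g => [|n IH] g; first by rewrite mulr0n (act0 hact).
  by rewrite (act_mulrSn hact) -(actD hact (v *+ n)) fv (actD hact).
case=> n g; first by rewrite -pmulrn fn.
rewrite NegzE mulrNz -pmulrn -(actD hact) -(fn n.+1) -(actD hact).
by rewrite addrA subrr add0r.
Qed.

Variables (A : set X).
Hypothesis mA : measurable A.
Variables (n : nat) (h : nat -> Z2) (psi : nat -> X -> R).
Hypothesis h0 : forall i, (i < n)%N -> h i != 0.
Hypothesis hdet : forall i j, (i < n)%N -> (j < n)%N -> i != j ->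
  detz (h i) (h j) != 0.
Hypothesis bpsi : forall i, bm (psi i).
Hypothesis psih : forall i, (i < n)%N -> forall x, psi i (act (h i) x) = psi i x.
Hypothesis psiE : {ae mu, forall x, \1_A x = \sum_(i < n) psi i x}.

(** A common multiple of the determinants of all pairs, so that [det_prod] times any vector is an
    integral combination of any two of the [h i]. The diagonal determinants vanish and are replaced
    by 1. *)
Definition det_prod : nat :=
  \prod_(i < n) \prod_(j < n) (if i == j then 1 else `|detz (h i) (h j)|)%N.

Lemma det_prod_gt0 : (0 < det_prod)%N.
Proof.
apply: prodn_cond_gt0 => i _; apply: prodn_cond_gt0 => j _.
by case: eqP => // /eqP ij; rewrite absz_gt0 hdet// ltn_ord.
Qed.

Lemma det_dvd_det_prod i j : (i < n)%N -> (j < n)%N -> i != j ->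
  exists s : int, det_prod%:Z = detz (h i) (h j) * s.
Proof.
move=> i_n j_n ij.
have : (`|detz (h i) (h j)| %| det_prod)%N.
  rewrite /det_prod (bigD1 (Ordinal i_n))//= dvdn_mulr//.
  rewrite (bigD1 (Ordinal j_n))//= dvdn_mulr//.
  by rewrite ifF//; apply/negP => /eqP [e]; rewrite e eqxx in ij.
rewrite -[det_prod]/(`|det_prod%:Z|%N) => /dvdzP[s ->].
by exists s; rewrite mulrC.
Qed.

Lemma det_prod_combination i j (z : Z2) (q : nat) :
  (i < n)%N -> (j < n)%N -> i != j ->
  exists a b : int, z *+ (q * det_prod) = (h i *+ q) *~ a + h j *~ b.
Proof.
move=> i_n j_n ij; have [s es] := det_dvd_det_prod i_n j_n ij.
exists (detz z (h j) * s), (detz (h i) z * s * q%:Z).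
rewrite mulnC mulrnA [z *+ _]pmulrn es mulrzA detz_cramer.
by apply: Z2_eqP; rewrite /= !pmulrn /= ?(mulrz_fst, mulrz_snd) /=
  ?(mulrz_fst, mulrz_snd); ring.
Qed.

(* Apply a difference operator in each direction [h j], [j != i]: it kills every
   [psi j] with [j != i], so the result for [psi i] is the one for [\1_A], an
   integer; on [h i]-invariant functions these operators all agree with the
   difference along [v *+ det_prod]. *)
Lemma psi_polynomial i (v : Z2) : (i < n)%N ->
  exists m, {ae mu, forall x,
    iter m (diffop (v *+ det_prod)) (psi i) x \is a Num.int}.
Proof.
move=> i_n; pose s := [seq j <- iota 0 n | j != i].
have /choice[u uP] : forall j, exists u : Z2, j \in s ->
    (forall x, psi j (act u x) = psi j x) /\
    exists b : int, v *+ det_prod = u + h i *~ b.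
  move=> j; have [js|js] := boolP (j \in s); last by exists 0.
  move: js; rewrite mem_filter mem_iota add0n => /andP[ji j_n].
  rewrite eq_sym in ji.
  (* The [h j] part of [v *+ det_prod] fixes [psi j], and its [h i] part is invisible to [psi i]. *)
  have [a [b e]] := det_prod_combination v 1 i_n j_n ji.
  rewrite mul1n mulr1n addrC in e.
  exists (h j *~ b) => _; split; last by exists a.
  by apply: (act_invariant_mulrz hact); exact: psih.
exists (size s); apply: filterS (ae_orbit hact psiE) => x hx.
rewrite -(@diffop_prod_iter u s (psi i) (h i)); first last.
- by move=> j /uP[].
- exact: psih.
have -> : diffop_prod u s (psi i) x = diffop_prod u s (\1_A) x.
  rewrite -[x](act0 hact) (diffop_prod_sum u s hx) (bigD1 (Ordinal i_n))//=.
  rewrite big1 ?addr0// => j ji; apply: (@diffop_prod_eq0 _ _ _ j).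
    by rewrite mem_filter mem_iota /= ltn_ord andbT.
  apply: (uP j _).1; by rewrite mem_filter mem_iota /= ltn_ord andbT.
by apply: diffop_prod_int => y; rewrite indicE; case: (_ \in A).
Qed.

(** [fs] is the conditional expectation of [\1_A] along [h i *+ q]. Averaging the decomposition
    fixes [psi i] and turns each other [psi j] into a function invariant along both [h i *+ q] and
    [h j], hence under [q * det_prod]. *)
Lemma directional_average i q : (i < n)%N -> exists fs : X -> R,
  [/\ bm fs, forall x, 0 <= fs x <= 1,
    forall x, fs (act (h i *+ q) x) = fs x,
    (forall g : X -> R, bm g -> {ae mu, forall x, g (act (h i *+ q) x) = g x} ->
      J (fun x => g x * fs x) = J (fun x => g x * \1_A x)) &
    {ae mu, forall x, forall z : Z2,
      fs (act (z *+ (q * det_prod)) x) - psi i (act (z *+ (q * det_prod)) x) =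
      fs x - psi i x}].
Proof.
move=> i_n; have bA : bm (\1_A : X -> R) by exact: bm_indic.
pose T := act (h i *+ q).
have mT : measurable_fun [set: X] T by exact: (act_measurable hact).
have muT : forall E, measurable E -> mu (T @^-1` E) = mu E.
  by move=> E; exact: (act_preserving hact).
have [fs [bfs fsT fs01 fscv]] := birkhoff mT muT bA.
exists fs; split => //.
- apply: fs01 => x; rewrite indicE; case: (_ \in A); by rewrite /= ?lexx ler01.
- by move=> g bg gT; exact: (expect_ergodic_limit mT muT bA bfs bg gT fscv).
have /choice[F FP] : forall j, exists F : X -> R, [/\ bm F,
    forall x, F (T x) = F x &
    {ae mu, forall x, ergodic_avg T (psi j) m x @[m --> \oo] --> F x}].
  move=> j; have [F [h1 h2 _ h4]] := birkhoff mT muT (bpsi j); by exists F.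
have Fcv : {ae mu, forall x, forall j,
    ergodic_avg T (psi j) m x @[m --> \oo] --> F j x}.
  by apply: ae_countable => j; have [] := FP j.
apply: filterS3 (ae_orbit hact fscv) (ae_orbit hact Fcv) (ae_orbit hact psiE).
move=> x cvA cvF eA.
have iT k g : iter k T (act g x) = act (h i *+ q *+ k + g) x.
  by rewrite (iter_act hact) -(actD hact).
have fsE g : fs (act g x) - psi i (act g x) =
    \sum_(j < n | j != i :> nat) F j (act g x).
  have -> : psi i (act g x) = F i (act g x).
    apply/esym; apply: (cvg_unique (@Rhausdorff R) (cvF g i)).
    rewrite (_ : (fun m => _) = (fun=> psi i (act g x))); first exact: cvg_cst.
    apply/funext => m; rewrite /ergodic_avg.
    under eq_bigr => k _.
      rewrite (iter_act hact) -mulrnA (pmulrn (h i)).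
      rewrite (act_invariant_mulrz hact); last exact: psih.
      over.
    by rewrite sumr_const card_ord -[_ *+ _]mulr_natr mulfK ?pnatr_eq0.
  have -> : fs (act g x) = \sum_(j < n) F j (act g x).
    apply: (cvg_unique (@Rhausdorff R) (cvA g)).
    have -> : (fun m => ergodic_avg T \1_A m (act g x)) =
        (fun m => \sum_(j < n) ergodic_avg T (psi j) m (act g x)).
      apply/funext => m; rewrite /ergodic_avg -mulr_suml; congr (_ / _).
      rewrite exchange_big; apply: eq_bigr => k _.
      by rewrite iT eA.
    by apply: cvg_big => [|j _]; [exact: add_continuous | exact: cvF].
  by rewrite (bigD1 (Ordinal i_n))//= addrAC subrr add0r; apply: eq_bigl.
move=> z; rewrite fsE -{2 3}[x](act0 hact) fsE; apply: eq_bigr => j ji.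
have ij : i != j by rewrite eq_sym.
have [a [b ->]] := det_prod_combination z q i_n (ltn_ord j) ij.
have Fh : forall g : Z2, F j (act (h j) (act g x)) = F j (act g x).
  move=> g; rewrite -(actD hact).
  apply: (cvg_unique (@Rhausdorff R) (cvF (h j + g) j)).
  rewrite (_ : (fun m => _) = (fun m => ergodic_avg T (psi j) m (act g x))).
    exact: cvF.
  apply/funext => m; rewrite /ergodic_avg; congr (_ / _).
  apply: eq_bigr => k _; rewrite !iT addrCA (actD hact).
  by rewrite psih.
have FT : forall y, F j (act (h i *+ q) y) = F j y by have [] := FP j.
rewrite (actD hact) (act_invariant_mulrz hact a FT).
by have := orbit_invariant_mulrz Fh b 0; rewrite !(act0 hact).
Qed.

(* Here [fs] is the average of [\1_A] along [h i *+ Q], which preserves [E];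
   averages along [h i] itself need not have the mean of [\1_A] on [E]. *)
Lemma irrational_component_half (Q m : nat) E i (w : Z2) (a : R) :
  component Q E -> (i < n)%N -> irrational_mod1 a ->
  {ae mu, forall x, E x ->
    iter m.+1 (diffop (w *+ Q)) (psi i) x - a \is a Num.int} ->
  mu (E `&` A) = (mu E * (2^-1)%:E)%E.
Proof.
move=> cE i_n ira psia; have [mE iE E0] := component_sub hact cE.
have [fs [bfs fs01 fsT fsJ fsk]] := directional_average Q i_n.
(* Multiples of [Q] preserve [E], and along multiples of [Q * D] the functions [fs] and [psi i] have
   equal differences. *)
pose D := det_prod; pose W := w *+ (Q * D).
have bi : bm (\1_E : X -> R) by exact: bm_indic.
have EW : {ae mu, forall x, E (act W x) <-> E x}.
  by move: iE; rewrite /lattice_inv; apply: filterS => x /(_ (w *+ D)); rewrite /W mulnC mulrnA.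
have irD' : irrational_mod1 (a *+ (D ^ m.+1)).
  by apply: irrational_mod1M => //; rewrite expn_gt0 det_prod_gt0.
have fsa : {ae mu, forall x, E x ->
    iter m.+1 (diffop W) fs x - a *+ (D ^ m.+1) \is a Num.int}.
  have iE' := ae_orbit hact (lattice_inv_act iE).
  apply: filterS3 (ae_orbit hact psia) iE' (ae_orbit hact fsk).
  move=> x h1 h2 h3 Ex.
  have e := @iter_diffop_eq m W fs (psi i) x (fun g => h3 g w) 0.
  rewrite (act0 hact) in e; rewrite e /W mulrnA -[x](act0 hact) -(mulr0n (w *+ Q)).
  apply: (iter_diffop_mulrn hact) => k; apply: h1.
  by have := h2 0; rewrite (act0 hact) mulrnAC => /(_ Ex).
have : J (fun x => \1_E x * fs x) = fine (mu E) / 2.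
  apply: expect_equidistributed => //; first exact: bfs.1.
  (* The phase [p * fs + c] has the top difference [a *+ (D ^ m.+1) *+ p] modulo 1 on [E], still
     irrational, so every positive frequency has mean zero. *)
  move=> p c p0.
  apply: (expect_irrational_phase hact (n := m) (w := W)
    (a := a *+ (D ^ m.+1) *+ p)) => //.
  - by apply: measurable_funD => //; apply: measurable_funM => //; exact: bfs.1.
  - exact: irrational_mod1M.
  apply: filterS fsa => x h1 Ex; rewrite iter_diffop_affine.
  by rewrite -[X in _ - X]mulr_natl -mulrBr rpredM ?natr_int// h1.
rewrite fsJ//; last first.
  move: iE; rewrite /lattice_inv; apply: filterS => x /(_ (h i)) e; rewrite !indicE.
  by congr (nat_of_bool _)%:R; apply/idP/idP; rewrite !inE => /e.
have mEA : measurable (E `&` A) by exact: measurableI.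
have -> : J (fun x => \1_E x * \1_A x) = fine (mu (E `&` A)).
  rewrite -expect_indic//; congr expect; apply/funext => x.
  by rewrite indicI.
by move=> e; rewrite (muE mu mEA) e EFinM -(muE mu mE).
Qed.

(** On the invariant level set [fs = c] the functions [fs] and [\1_A] have the same integral. For
    [c] equal to 0 or 1 their difference has a constant sign there, hence vanishes almost
    everywhere. *)
Lemma average_eq01 i (fs : X -> R) : bm fs -> (forall x, 0 <= fs x <= 1) ->
  (forall x, fs (act (h i *+ 1) x) = fs x) ->
  (forall g : X -> R, bm g -> {ae mu, forall x, g (act (h i *+ 1) x) = g x} ->
      J (fun x => g x * fs x) = J (fun x => g x * \1_A x)) ->
  {ae mu, forall x, fs x \is a Num.int -> fs x = \1_A x}.
Proof.
move=> bfs fs01 fsT fsJ.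
have bA : bm (\1_A : X -> R) by exact: bm_indic.
have mS (c : R) : measurable (fs @^-1` [set c]).
  by rewrite -[X in measurable X]setTI; apply: bfs.1.
have bS c : bm (\1_(fs @^-1` [set c]) : X -> R) by exact: bm_indic.
have sol c : {ae mu, forall x, 0 <= \1_(fs @^-1` [set c]) x * (\1_A x - fs x)} \/
   {ae mu, forall x, 0 <= \1_(fs @^-1` [set c]) x * (fs x - \1_A x)} ->
   {ae mu, forall x, fs x = c -> fs x = \1_A x}.
  have e : J (fun x => \1_(fs @^-1` [set c]) x * fs x) =
      J (fun x => \1_(fs @^-1` [set c]) x * \1_A x).
    apply: fsJ => //; apply: aeW => x; rewrite !indicE.
    congr (nat_of_bool _)%:R; apply/idP/idP; rewrite !inE /=.
      by rewrite fsT.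
    by rewrite fsT.
  have b1 := bmM (bS c) bfs.
  have b2 := bmM (bS c) bA.
  case=> ge0.
    have : {ae mu, forall x, \1_(fs @^-1` [set c]) x * (\1_A x - fs x) = 0}.
      apply: expect_ge0_eq0 => //; first exact: (bmM (bS c) (bmB _ _)).
      under eq_fun do rewrite mulrBr.
      by rewrite expectB// e subrr.
    apply: filterS => x hx fx; move: hx; rewrite indicE mem_set//= mul1r.
    by move/eqP; rewrite subr_eq0 => /eqP.
  have : {ae mu, forall x, \1_(fs @^-1` [set c]) x * (fs x - \1_A x) = 0}.
    apply: expect_ge0_eq0 => //; first exact: (bmM (bS c) (bmB _ _)).
    under eq_fun do rewrite mulrBr.
    by rewrite expectB// e subrr.
  apply: filterS => x hx fx; move: hx; rewrite indicE mem_set//= mul1r.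
  by move/eqP; rewrite subr_eq0 => /eqP.
have s0 : {ae mu, forall x, fs x = 0 -> fs x = \1_A x}.
  apply: sol; left; apply: aeW => x; rewrite indicE.
  case: (boolP (x \in _)) => [/set_mem /= ->|_]; last by rewrite mul0r.
  by rewrite mul1r subr0 indicE.
have s1 : {ae mu, forall x, fs x = 1 -> fs x = \1_A x}.
  apply: sol; right; apply: aeW => x; rewrite [X in X * _]indicE.
  case: (boolP (x \in _)) => [/set_mem /= ->|_]; last by rewrite mul0r.
  by rewrite mul1r subr_ge0 indicE; case: (_ \in A).
apply: filterS2 s0 s1 => x h1 h2 /intrP[z ez].
have /andP[] := fs01 x; rewrite ez ler0z (ler_int _ z 1) => z0 z1.
have [|] : z = 0 \/ z = 1 by lia.
  by move=> e; rewrite -ez; apply: h1; rewrite ez e.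
by move=> e; rewrite -ez; apply: h2; rewrite ez e.
Qed.

Lemma indic_eq_iff x y : \1_A x = \1_A y :> R -> (A x <-> A y).
Proof.
rewrite !indicE => /eqP; rewrite eqr_nat.
case: (boolP (x \in A)) => [/set_mem Ax|nAx];
  case: (boolP (y \in A)) => [/set_mem Ay|nAy] //= _.
by split => [/mem_set|/mem_set]; rewrite ?(negPf nAx) ?(negPf nAy).
Qed.

Lemma periodic_of_ae E (g : Z2) : {ae mu, forall x, E (act g x) <-> E x} ->
  g != 0 -> {ae mu, forall x, E x -> (A (act g x) <-> A x)} ->
  one_periodic mu act (E `&` A).
Proof.
move=> Eg g0 Ag; exists (- g); first by rewrite oppr_eq0.
apply/(fixes_mod_nullP hact); rewrite opprK.
apply: filterS2 Eg Ag => x h1 h2; split => -[].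
  by move=> /h1 Ex Ax; split => //; apply/h2.
by move=> Ex Ax; split; [apply/h1|apply/h2].
Qed.

Lemma constant_component_periodic (Q : nat) E :
  (0 < Q)%N -> (det_prod %| Q)%N -> component Q E ->
  (forall i, (i < n)%N -> exists c : R,
    {ae mu, forall x, E x -> psi i x - c \is a Num.int}) ->
  one_periodic mu act (E `&` A).
Proof.
move=> Q0 DQ cE psic; have [mE iE E0] := component_sub hact cE.
have Einv (z : Z2) : {ae mu, forall x, E (act (z *+ Q) x) <-> E x}.
  by move: iE; rewrite /lattice_inv; apply: filterS.
have Qz : Q%:Z != 0 by rewrite eqz_nat -lt0n.
have zQ (z : Z2) : z != 0 -> z *+ Q != 0.
  by move=> z0; rewrite pmulrn; exact: mulrz_eq0_Z2.
have [[i [i_n [fs [bfs fs01 fsT fsJ fsE]]]]|none] := pselect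
  (exists i, (i < n)%N /\ exists fs : X -> R,
    [/\ bm fs, forall x, 0 <= fs x <= 1,
    forall x, fs (act (h i *+ 1) x) = fs x,
    (forall g : X -> R, bm g -> {ae mu, forall x, g (act (h i *+ 1) x) = g x} ->
      J (fun x => g x * fs x) = J (fun x => g x * \1_A x)) &
    {ae mu, forall x, E x -> fs x \is a Num.int}]).
  have AE := ae_orbit hact (average_eq01 bfs fs01 fsT fsJ).
  apply: (periodic_of_ae (Einv (h i))); first exact/zQ/h0.
  apply: filterS3 AE (Einv (h i)) (ae_orbit hact fsE) => x h1 h2 h3 Ex.
  have e1 := h1 0; have e2 := h1 (h i *+ Q); have i1 := h3 0.
  rewrite (act0 hact) in e1 i1.
  have e : fs (act (h i *+ Q) x) = fs x.
    rewrite -[Q]mul1n mulrnA pmulrn; exact: (act_invariant_mulrz hact).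
  apply: indic_eq_iff; rewrite -e1; last exact: i1.
  by rewrite -e2; [exact: e | exact: h3 (h2.2 Ex)].
have psicst i : (i < n)%N -> exists c : R, {ae mu, forall x, E x -> psi i x = c}.
  move=> i_n; have [fs [bfs fs01 fsT fsJ fsk]] := directional_average 1 i_n.
  have [c hc] := psic i i_n.
  have [|k hk] := component_constant hact cE (bmB bfs (bpsi i)).
    move/dvdnP: DQ => [t eQ]; apply: filterS fsk => x hx _ z.
    by have := hx (z *+ t); rewrite mul1n -mulrnA -eQ.
  have nint : ~ (c + k \is a Num.int).
    move=> ck; apply: none; exists i; split => //; exists fs; split => //.
    apply: filterS2 hc hk => x h1 h2 Ex.
    have -> : fs x = (psi i x - c) + (c + k) by rewrite -(h2 Ex); ring.
    by rewrite rpredD// h1.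
  (* On [E] the average [fs] is congruent to the non-integer [c + k], so within [[0, 1]] it can only
     be the fractional part of [c + k]. *)
  exists (c + k - (Num.floor (c + k))%:~R - k).
  apply: filterS2 hc hk => x h1 h2 Ex.
  suff : fs x = c + k - (Num.floor (c + k))%:~R.
    by have := h2 Ex; lra.
  have /intrP[z ez] : fs x - (c + k) \is a Num.int.
    have -> : fs x - (c + k) = psi i x - c by rewrite -(h2 Ex); ring.
    exact: h1.
  have -> : fs x = c + k + z%:~R by rewrite -ez; ring.
  congr (_ + _); rewrite -mulrNz; congr (_%:~R).
  have /andP[f0 f1] := fs01 x.
  have fx : fs x = c + k + z%:~R by rewrite -ez; ring.
  suff -> : Num.floor (c + k) = - z by rewrite opprK.
  apply: floor_def; rewrite intrD mulrNz.
  have fx1 : fs x != 1.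
    apply/eqP => e; apply: nint.
    have -> : c + k = 1 - z%:~R by lra.
    by rewrite rpredB ?int_num1 ?intr_int.
  have {}f1 : fs x < 1 by rewrite lt_neqAle fx1.
  by apply/andP; split; rewrite fx in f0 f1; lra.
have /choice[c hc] : forall i, exists c : R, (i < n)%N ->
    {ae mu, forall x, E x -> psi i x = c}.
  move=> i; have [i_n|] := ltnP i n; last by exists 0.
  by have [c hc] := psicst i i_n; exists c.
have hca : {ae mu, forall x, forall i, (i < n)%N -> E x -> psi i x = c i}.
  apply: ae_countable => i; have [i_n|ni] := ltnP i n.
    by apply: filterS (hc i i_n) => x hx _.
  exact: aeW.
have Acst : {ae mu, forall x, E x -> (\1_A x : R) = \sum_(i < n) c i}.
  apply: filterS2 psiE hca => x -> h2 Ex; apply: eq_bigr => i _; exact: h2.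
have g10 : ((1, 0) : Z2) != 0 by [].
(* Any nonzero vector would do, as [\1_A] is constant on [E]. *)
apply: (periodic_of_ae (Einv (1, 0))); first exact: zQ.
apply: filterS2 (ae_orbit hact Acst) (Einv (1, 0)) => x h1 h2 Ex.
have := h1 0; rewrite (act0 hact) => /(_ Ex) e1.
by apply: indic_eq_iff; rewrite e1 (h1 ((1, 0) *+ Q) (h2.2 Ex)).
Qed.

End Assembly.

Lemma transversal_exists (u : Z2) : u != 0 -> exists v : Z2, detz u v != 0.
Proof.
move=> u0; have [u1|u1] := eqVneq u.1 0.
  exists (1, 0); rewrite /detz u1 mul0r sub0r oppr_eq0 mulr1.
  by apply: contra u0 => /eqP u2; apply/eqP; exact: Z2_eqP.
by exists (0, 1); rewrite /detz mulr1 mulr0 subr0.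
Qed.

Theorem theorem4p4 (R : realType) (d : measure_display) (X : measurableType d)
    (mu : probability X R) (act : Z2 -> X -> X)
    (hact : measure_preserving_action mu act)
    (herg : ergodic_action mu act)
    (A : set X) (mA : measurable A)
    (hAnn : Ann mu act \1_A <> [set laurent0]) :
  exists L : {pred Z2},
    [/\ zmod_closed L, finite_index L &
      forall Xs : set X, ergodic_component mu act L Xs ->
        one_periodic mu act (Xs `&` A) \/
        mu (Xs `&` A) = (mu Xs * (2^-1)%:E)%E].
Proof.
have [n [h [psi [h0 hdet bpsi psih psiE]]]] := Ann_decomposition hact mA hAnn.
pose D := det_prod n h; have D0 : (0 < D)%N by exact: det_prod_gt0.
have /choice[v vP] : forall i, exists v : Z2, (i < n)%N -> detz (h i) v != 0.
  move=> i; have [i_n|] := ltnP i n; last by exists 0.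
  by have [v hv] := transversal_exists (h0 i i_n); exists v.
(* [psi_polynomial] provides integer differences along [D] times a vector; scaling [v i] keeps it
   transversal to [h i]. *)
pose w i := v i *+ D.
pose P i Q := (0 < Q)%N -> forall E, ergodic_component mu act (sublattice Q) E ->
  good_component mu act Q E (psi i) (w i).
have [|Q1 Q10 hQ1] := @common_multiple n P.
  move=> i i_n; have [m hm] := psi_polynomial hact psih psiE (v i) i_n.
  have hw : detz (h i) (w i) != 0.
    rewrite /w detzC pmulrn detz_mulrzl oppr_eq0 mulf_neq0 ?eqz_nat -?lt0n//.
    by rewrite detzC oppr_eq0 vP.
  have [|||Q1 Q10 hQ1] := phase_dichotomy hact herg (n := m) (Q := 1) (E := setT)
    hw (bpsi i).1 (psih i i_n) isT.
  - exact: measurableT.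
  - exact: aeW.
  - by apply: filterS hm => x hx _; rewrite mulr1n.
  exists Q1 => // Q' hQ' Q'0 E cE; apply: (hQ1 Q') => //; exact: aeW.
(* The factor [D] makes the averages along [h i] differ from [psi i] by constants on the
   components. *)
pose Q := (Q1 * D)%N.
have Q0 : (0 < Q)%N by rewrite muln_gt0 Q10.
have Q1Q : (Q1 %| Q)%N by exact: dvdn_mulr.
exists (sublattice Q); split; first exact: sublattice_zmod_closed.
  exact: sublattice_finite_index.
move=> E cE.
have [[i [i_n [m [a [ira ha]]]]]|none] := pselect (exists i, (i < n)%N /\
    exists (m : nat) (a : R), irrational_mod1 a /\
    {ae mu, forall x, E x ->
      iter m.+1 (diffop act (w i *+ Q)) (psi i) x - a \is a Num.int}).
  by right; exact: (irrational_component_half hact mA hdet bpsi psih psiE cE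
    i_n ira ha).
left; apply: (constant_component_periodic hact mA h0 bpsi psih psiE Q0 _ cE).
  exact: dvdn_mull.
move=> i i_n; have [//|hr] := hQ1 Q Q1Q i i_n Q0 E cE.
by exfalso; apply: none; exists i.
Qed.
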